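(* Let $W$ be a finite Weyl group with $r$ irreducible components and Dynkin diagram $\Gamma$. Then: (1) The map $\mathcal{N}\mapsto w(\mathcal{N}):=\prod_{J\in\mathcal{N}}w_0(J)$, where the product is taken in any monotonic order of $\mathcal{N}$, is a well-defined bijection from the set of nested sets on $\Gamma$ to the set of separable elements of $W$. Consequently the number of separable elements of $W$ is $2^r$ times the number of faces of the graph associahedron $A(\Gamma)$. (2) For every nested set $\mathcal{N}$ on $\Gamma$, \[ \Lambda^L_{w(\mathcal{N})}(q)=q^{\ell(w(\mathcal{N}))}\Lambda^R_{w(\mathcal{N})}(q^{-1})=\frac{\prod_{J\in\mathcal{N}_{even}}W_J(q)}{\prod_{J\in\mathcal{N}_{odd}}W_J(q)}. \]
   Context: $\Phi$ is a finite crystallographic root system with simple roots $\Delta$, positive roots $\Phi^+$, Weyl group $W=W(\Phi)$ generated by simple reflections $s_\alpha$; $\ell$ is Coxeter length; $I_\Phi(w)=\{\beta\in\Phi^+:w\beta\in-\Phi^+\}$. Left weak order: $v\leq_L w$ iff $I_\Phi(v)\subseteq I_\Phi(w)$; right weak order: $v\leq_R w$ iff $v^{-1}\leq_L w^{-1}$. $\Lambda^L_w(q)=\sum_{v\leq_L w}q^{\ell(v)}$ and $\Lambda^R_w(q)=\sum_{v\leq_R w}q^{\ell(v)}$. For $J\subseteq\Delta$, $W_J$ is the parabolic subgroup generated by $\{s_\alpha:\alpha\in J\}$, $w_0(J)$ its longest element, and $W_J(q)=\sum_{v\in W_J}q^{\ell(v)}$. Root poset: $\beta\leq\beta'$ iff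 $\beta'-\beta$ is a nonnegative combination of simple roots. $\Phi_J$ is the set of roots in the span of $J$; for a subsystem $\Phi'=\Phi\cap V$, $w|_{\Phi'}\in W(\Phi')$ is the element with inversion set $I_\Phi(w)\cap V$. Separable elements are defined recursively: $w$ is separable if (S1) $\Phi$ has type $A_1$; or (S2) $\Phi=\bigoplus\Phi_i$ is reducible and each $w|_{\Phi_i}$ is separable; or (S3) $\Phi$ is irreducible and some $\alpha_i\in\Delta$ has $w|_{\Phi_{\Delta\setminus\{\alpha_i\}}}$ separable and either $\{\beta\in\Phi^+:\beta\geq\alpha_i\}\subseteq I_\Phi(w)$ or this set is disjoint from $I_\Phi(w)$. The Dynkin diagram $\Gamma$ is the (simple, undirected) graph on vertex set $\Delta$ with an edge between $\alpha,\alpha'$ whenever $s_\alpha,s_{\alpha'}$ do not commute; subsets of vertices are identified with subsets of $\Delta$. A nested set on $\Gamma$ is a collection $\mathcal{N}$ of vertex subsets such that (N1) each $J\in\mathcal{N}$ induces a connected subgraph; (N2) any $I,J\in\mathcal{N}$ satisfy $I\subseteq J$, $J\subseteq I$, or $I\cap J=\emptyset$; (N3) for any $k\geq 2$ pairwise disjoint $J_1,\dots,J_k\in\mathcal{N}$, the induced subgraph on $J_1\cup\cdots\cup J_k$ is not connected. A total order on $\mathcal{N}$ is monotonic if $J$ comes after $I$ whenever $J\subseteq I$. The depth of $J\in\mathcal{N}$ is the maximum $k$ such that there is a chain $J\subsetneq I_1\subsetneq\cdots\subsetneq I_k$ in $\mathcal{N}$; $\mathcal{N}_{even}$, $\mathcal{N}_{odd}$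 are the elements of even and odd depth. The graph associahedron $A(\Gamma)$ is the Minkowski sum over all nonempty vertex subsets $J$ inducing connected subgraphs of the simplices $\mathrm{conv}\{e_j: j\in J\}\subset\mathbb{R}^{\Delta}$; its faces are counted over all dimensions. *)

(* Defs.v *)
From HB Require Import structures.
From mathcomp Require Import all_boot all_order all_algebra.
From mathcomp Require Import boolp classical_sets cardinality fsbigop.
Set Implicit Arguments. Unset Strict Implicit. Unset Printing Implicit Defensive.
Import Order.TTheory GRing.Theory Num.Theory.
Local Open Scope classical_set_scope.
Local Open Scope ring_scope.

Section Weyl.
Variables (n : nat) (C : 'M[int]_n).

(* C is a (generalized) Cartan matrix; together with finiteness of W this
   means C is a Cartan matrix of a finite (reduced) crystallographic root
   system Phi, with simple roots Delta = 'I_n.  Vectors are written in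
   coordinates with respect to the simple roots (column vectors). *)
Definition is_cartan : Prop :=
  (forall i, C i i = 2) /\ (forall i j, i != j -> C i j <= 0) /\
  (forall i j, C i j = 0 <-> C j i = 0).

Definition sroot (i : 'I_n) : 'cV[int]_n := delta_mx i 0.

(* simple reflection s_i : beta |-> beta - <alpha_i^vee, beta> alpha_i,
   with <alpha_i^vee, alpha_j> = C i j; acting on the left on column vectors *)
Definition sref (i : 'I_n) : 'M[int]_n :=
  1%:M - \matrix_(k, j) ((k == i)%:R * C i j).

Definition word_elt (s : seq 'I_n) : 'M[int]_n :=
  foldr (fun i M => sref i *m M) 1%:M s.

Definition WJ (J : {set 'I_n}) : set 'M[int]_n :=
  [set w | exists s : seq 'I_n, all (fun i => i \in J) s /\ w = word_elt s].
Definition W : set 'M[int]_n := WJ [set: 'I_n]%SET.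

Definition roots : set 'cV[int]_n :=
  [set b | exists w i, W w /\ b = w *m sroot i].
Definition pos_roots : set 'cV[int]_n :=
  [set b | roots b /\ forall i, 0 <= b i 0].

Definition inv (w : 'M[int]_n) : set 'cV[int]_n :=
  [set b | pos_roots b /\ pos_roots (- (w *m b))].

Definition ell (w : 'M[int]_n) : nat :=
  xget 0%N [set k | (exists s, size s = k /\ w = word_elt s) /\
                    (forall s, w = word_elt s -> (k <= size s)%N)].

Definition leL (v w : 'M[int]_n) : Prop := inv v `<=` inv w.
Definition leR (v w : 'M[int]_n) : Prop := leL (invmx v) (invmx w).

Definition w0 (J : {set 'I_n}) : 'M[int]_n :=
  xget 1%:M [set w | WJ J w /\ forall v, WJ J v -> (ell v <= ell w)%N].

(* span of J, so Phi_J = roots `&` spanJ J *)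
Definition spanJ (J : {set 'I_n}) : set 'cV[int]_n :=
  [set b | forall i, i \notin J -> b i 0 = 0].

Definition rootle (b b' : 'cV[int]_n) : Prop := forall i, b i 0 <= b' i 0.

Definition restr (K : {set 'I_n}) (w : 'M[int]_n) : 'M[int]_n :=
  xget 1%:M [set v | WJ K v /\ inv v `&` spanJ K = inv w `&` spanJ K].

Definition adj (i j : 'I_n) : bool :=
  (i != j) && (sref i *m sref j != sref j *m sref i).

Definition edgeJ (J : {set 'I_n}) : rel 'I_n :=
  fun x y => [&& x \in J, y \in J & adj x y].

Definition connectedJ (J : {set 'I_n}) : bool :=
  (J != finset.set0) && [forall x in J, forall y in J, connect (edgeJ J) x y].

Definition is_comp (J K : {set 'I_n}) : bool :=
  [&& K \subset J, connectedJ K &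
      [forall x in K, forall y in (J :\: K)%SET, ~~ adj x y]].

Definition ncomp : nat := #|[set K : {set 'I_n} | is_comp [set: 'I_n] K]%SET|.

Fixpoint sep_aux (k : nat) (J : {set 'I_n}) (w : 'M[int]_n) : Prop :=
  match k with
  | 0 => False
  | k'.+1 =>
      #|J| = 1%N \/
      (~~ connectedJ J /\ forall K, is_comp J K -> sep_aux k' K (restr K w)) \/
      (connectedJ J /\ exists i, i \in J /\
         sep_aux k' (J :\ i)%SET (restr (J :\ i)%SET w) /\
         (let U := [set b | pos_roots b /\ spanJ J b /\ rootle (sroot i) b] in
          U `<=` inv w \/ U `&` inv w = set0))
  end.

Definition separable : set 'M[int]_n :=
  [set w | W w /\ sep_aux n.+1 [set: 'I_n]%SET w].

Definition nested (N : {set {set 'I_n}}) : Prop :=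
  (forall J, J \in N -> connectedJ J) /\
  (forall I J, I \in N -> J \in N ->
     ([|| I \subset J, J \subset I | (disjoint (mem I) (mem J))]%SET)) /\
  (forall S : {set {set 'I_n}}, S \subset N -> (2 <= #|S|)%N ->
     (forall I J, I \in S -> J \in S -> I != J -> disjoint (mem I) (mem J)) ->
     ~~ connectedJ (\bigcup_(J in S) J)%SET).

Definition monotonic (N : {set {set 'I_n}}) (s : seq {set 'I_n}) : Prop :=
  uniq s /\ (forall J, (J \in s) = (J \in N)) /\
  (forall I J, I \in N -> J \in N -> J \subset I -> I != J ->
     (index I s < index J s)%N).

Definition wprod (s : seq {set 'I_n}) : 'M[int]_n :=
  foldr (fun J M => w0 J *m M) 1%:M s.

Definition depth (N : {set {set 'I_n}}) (J : {set 'I_n}) : nat :=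
  (\max_(k < #|N|.+1 |
      [exists t : k.-tuple {set 'I_n},
         path (fun A B : {set 'I_n} => A \proper B) J t &&
         all (fun A => A \in N) t]) k)%N.

Definition LamL (R : fieldType) (w : 'M[int]_n) (q : R) : R :=
  \sum_(v \in [set v | W v /\ leL v w]) q ^+ ell v.
Definition LamR (R : fieldType) (w : 'M[int]_n) (q : R) : R :=
  \sum_(v \in [set v | W v /\ leR v w]) q ^+ ell v.
Definition WJq (R : fieldType) (J : {set 'I_n}) (q : R) : R :=
  \sum_(v \in WJ J) q ^+ ell v.

Definition simplexJ (R : realFieldType) (J : {set 'I_n}) : set 'rV[R]_n :=
  [set y | (forall j, 0 <= y 0 j) /\ (forall j, j \notin J -> y 0 j = 0) /\
           \sum_j y 0 j = 1].

Definition assoc (R : realFieldType) : set 'rV[R]_n :=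
  [set x | exists y : {set 'I_n} -> 'rV[R]_n,
     (forall J, connectedJ J -> simplexJ J (y J)) /\
     x = \sum_(J | connectedJ J) y J].

(* (nonempty) faces: sets of maximizers of linear functionals *)
Definition faces (R : realFieldType) : set (set 'rV[R]_n) :=
  [set F | exists c : 'rV[R]_n,
     F = [set x | assoc (R:=R) x /\
            forall y, assoc (R:=R) y -> \sum_i c 0 i * y 0 i <= \sum_i c 0 i * x 0 i]].

End Weyl.

(* Main.v *)
(** The proof rests on the following description: a positive root [b] is an
    inversion of [w(N)] iff the number of members of [N] containing the support
    of [b] is odd.  Elements of [W] are determined by their inversions, and the
    supports of roots are exactly the connected sets, so this gives
    independence of the monotonic order and injectivity.  Restricting to a
    connected [J] minus a vertex [i] either leaves the nested set unchanged or
    removes [J] and toggles the components of [J] minus [i]; this matches the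
    recursive definition of separability.

    For the generating functions, let [P] and [Q] be the unions of the members
    of depth 0 and 1.  Then [v <=_L w(N)] iff [v] is in [W_P] and the
    [W_Q]-part of [v] is below [w] of the members of depth at least 2; hence
    [Lambda(N) W_Q(q) = W_P(q) Lambda(N of depth >= 2)].

    The face of the graph associahedron maximizing [c] is determined by the
    sets where [c] is maximal on each connected [J], equivalently by the nested
    set of the components of the sublevel sets of [c].

    The dichotomy positive/negative for roots uses no classification: scaled by
    the norm of a root [b], the invariant form is integral on the lattice of
    vectors integral in both simple roots and simple coroots, so [b] cannot
    split into two nonzero parts with disjoint supports and nonnegative inner
    product. *)
From mathcomp Require Import all_boot all_order all_algebra finmap.
From mathcomp Require Import boolp classical_sets functions cardinality fsbigop.
From mathcomp Require Import ring zify.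
Require Import Defs.
Set Implicit Arguments.
Unset Strict Implicit.
Unset Printing Implicit Defensive.
Import Order.TTheory GRing.Theory Num.Theory.
Local Open Scope classical_set_scope.
Local Open Scope ring_scope.
Local Open Scope card_scope.

(** * Words in the simple reflections *)

Section Words.
Variables (n : nat) (C : 'M[int]_n).
Hypothesis cartanC : is_cartan C.

Implicit Types (i j k : 'I_n) (s t : seq 'I_n) (w v u : 'M[int]_n).
Implicit Types (b x y : 'cV[int]_n) (A J K : {set 'I_n}).

Definition coroot i x : int := \sum_j C i j * x j 0.

Lemma corootZD i c x y : coroot i (c *: x + y) = c * coroot i x + coroot i y.
Proof.
rewrite /coroot mulr_sumr -big_split; apply: eq_bigr => j _ /=; rewrite !mxE; ring.
Qed.

Lemma coroot_sroot i j : coroot i (sroot j) = C i j.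
Proof.
rewrite /coroot (bigD1 j) //= big1 => [|k /negPf kj]; last by rewrite !mxE kj mulr0.
by rewrite !mxE !eqxx addr0 mulr1.
Qed.

Lemma sref_mulE i x : sref C i *m x = x - coroot i x *: sroot i.
Proof.
apply/matrixP => k l; rewrite ord1 /sref mulmxBl mul1mx !mxE.
congr (_ - _); rewrite mulr_suml; apply: eq_bigr => j _.
by rewrite !mxE andbT; ring.
Qed.

Lemma sref_coord i x k : k != i -> (sref C i *m x) k 0 = x k 0.
Proof. by move=> ki; rewrite sref_mulE !mxE (negPf ki) mulr0 subr0. Qed.

Lemma mulmx_cV_inj (A B : 'M[int]_n) : (forall x : 'cV_n, A *m x = B *m x) -> A = B.
Proof.
by move=> AB; apply/matrixP => k l; have := AB (delta_mx l 0);
  rewrite -!colE => /matrixP/(_ k 0); rewrite !mxE.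
Qed.

Lemma sref_invol i : sref C i *m sref C i = 1%:M.
Proof.
have [C2 _] := cartanC.
apply: mulmx_cV_inj => x; rewrite -mulmxA mul1mx [sref C i *m x]sref_mulE.
set c := coroot i x; rewrite sref_mulE -scaleNr [x + _]addrC corootZD.
by rewrite coroot_sroot C2 -/c; apply/matrixP => k l; rewrite !mxE; ring.
Qed.

Lemma word_cat s t : word_elt C (s ++ t) = word_elt C s *m word_elt C t.
Proof. by elim: s => [|i s IH] /=; rewrite ?mul1mx // IH mulmxA. Qed.

Lemma word_rev s : word_elt C (rev s) *m word_elt C s = 1%:M.
Proof.
elim: s => [|i s IH] /=; first by rewrite mulmx1.
rewrite rev_cons -cats1 word_cat /= mulmx1 -mulmxA.
by rewrite [sref C i *m (_ *m _)]mulmxA sref_invol mul1mx.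
Qed.

Lemma word_unit s : word_elt C s \in unitmx.
Proof. by have /mulmx1_unit[] := word_rev s. Qed.

Lemma word_inv s : invmx (word_elt C s) = word_elt C (rev s).
Proof.
by rewrite -[RHS]mulmx1 -(mulmxV (word_unit s)) mulmxA word_rev mul1mx.
Qed.

Lemma WJ1 J : WJ C J 1%:M.
Proof. by exists [::]. Qed.

Lemma WJM J v w : WJ C J v -> WJ C J w -> WJ C J (v *m w).
Proof.
move=> [s [Js ->]] [t [Jt ->]]; exists (s ++ t).
by rewrite all_cat Js Jt word_cat.
Qed.

Lemma WJs J i : i \in J -> WJ C J (sref C i).
Proof. by move=> Ji; exists [:: i]; rewrite /= Ji mulmx1. Qed.

Lemma WJV J w : WJ C J w -> WJ C J (invmx w).
Proof. by move=> [s [Js ->]]; exists (rev s); rewrite all_rev word_inv. Qed.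

Lemma WJ_unit J w : WJ C J w -> w \in unitmx.
Proof. by move=> [s [_ ->]]; apply: word_unit. Qed.

Lemma WJ_invM J v w : WJ C J v -> WJ C J w -> invmx (v *m w) = invmx w *m invmx v.
Proof.
move=> Jv Jw; have Uv := WJ_unit Jv; have Uw := WJ_unit Jw.
have Uvw := WJ_unit (WJM Jv Jw).
apply: (can_inj (mulmxK Uvw)); rewrite mulVmx // -mulmxA (mulmxA (invmx v)) mulVmx //.
by rewrite mul1mx mulVmx.
Qed.

Lemma W_invM v w : W C v -> W C w -> invmx (v *m w) = invmx w *m invmx v.
Proof. exact: WJ_invM. Qed.

Lemma W_sref i : W C (sref C i).
Proof. by apply: WJs; rewrite finset.inE. Qed.

Lemma sref_inv i : invmx (sref C i) = sref C i.
Proof. by have := word_inv [:: i]; rewrite /= mulmx1. Qed.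

Lemma WJ_sub J K w : J \subset K -> WJ C J w -> WJ C K w.
Proof.
move=> /fintype.subsetP JK [s [/allP Js ->]]; exists s; split=> //.
by apply/allP => i /Js /JK.
Qed.

Lemma WJW J w : WJ C J w -> W C w.
Proof. by apply: WJ_sub; apply/fintype.subsetP=> i; rewrite inE. Qed.

Lemma W_word s : W C (word_elt C s).
Proof. by exists s; split=> //; apply/allP => i; rewrite inE. Qed.

Lemma WJ_ind J (P : 'M[int]_n -> Prop) :
  P 1%:M -> (forall i w, i \in J -> WJ C J w -> P w -> P (sref C i *m w)) ->
  forall w, WJ C J w -> P w.
Proof.
move=> P1 PM w [s [Js ->]]; elim: s Js => //= i s IH /andP[Ji Js].
by apply: PM => //; [exists s | apply: IH].
Qed.

Lemma WJ_coord J w : WJ C J w ->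
  forall x k, k \notin J -> (w *m x) k 0 = x k 0.
Proof.
move: w; apply: WJ_ind => [x k _|i w Ji _ IH x k kJ]; first by rewrite mul1mx.
rewrite -mulmxA sref_coord ?IH //.
by apply: contraNneq kJ => ->.
Qed.

Lemma WJ_fix J w : WJ C J w ->
  forall x, (forall i j, i \in J -> x j 0 != 0 -> C i j = 0) -> w *m x = x.
Proof.
move: w; apply: WJ_ind => [x _|i w Ji _ IH x xJ]; first by rewrite mul1mx.
rewrite -mulmxA IH // sref_mulE [coroot _ _]big1 ?scale0r ?subr0 // => j _.
by have [->|xj] := eqVneq (x j 0) 0; rewrite ?mulr0 // (xJ i j) ?mul0r.
Qed.

Lemma WJ_span J w x : WJ C J w -> spanJ J x -> spanJ J (w *m x).
Proof. by move=> Jw Jx k kJ; rewrite (WJ_coord Jw) // Jx. Qed.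

Lemma sum_sroot x : x = \sum_i x i 0 *: sroot i.
Proof.
apply/matrixP => k l; rewrite ord1 summxE (bigD1 k) //= big1 => [|j /negPf jk].
  by rewrite !mxE !eqxx mulr1 addr0.
by rewrite !mxE eq_sym jk mulr0.
Qed.

Lemma roots_W w b : W C w -> roots C b -> roots C (w *m b).
Proof.
move=> Ww [v [i [Wv ->]]]; exists (w *m v), i; split; last by rewrite mulmxA.
exact: WJM.
Qed.

Lemma sroot_root i : roots C (sroot i).
Proof. by exists 1%:M, i; rewrite mul1mx; split=> //; apply: WJ1. Qed.

Lemma sref_sroot i : sref C i *m sroot i = - sroot i.
Proof.
have [C2 _] := cartanC.
by rewrite sref_mulE coroot_sroot C2 scaler_nat mulr2n opprD addNKr.
Qed.

Lemma rootsN b : roots C b -> roots C (- b).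
Proof.
move=> [w [i [Ww ->]]]; exists (w *m sref C i), i; split.
  by apply: WJM => //; apply: WJs; rewrite inE.
by rewrite -mulmxA sref_sroot mulmxN.
Qed.

(** Applying [invmx w] turns [b = w *m sroot j] into a simple root, whose coordinate 1 is then a
    multiple of [c]. *)
Lemma root_primitive b i (c : int) : roots C b -> b = c *: sroot i -> c \is a GRing.unit.
Proof.
move=> [w [j [Ww ->]]] e; apply/unitrPr.
exists ((invmx w *m sroot i) j 0).
have := congr1 (fun x => (invmx w *m x) j 0) e.
by rewrite mulKmx ?(WJ_unit Ww) // -scalemxAr !mxE !eqxx.
Qed.

Lemma root_neq0 b : roots C b -> b <> 0.
Proof.
move=> [w [i [Ww ->]]] e.
have := congr1 (fun x => (invmx w *m x) i 0) e.
by rewrite mulKmx ?(WJ_unit Ww) // mulmx0 !mxE !eqxx.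
Qed.

End Words.

(** * The invariant form *)

Section Form.
Variables (n : nat) (C : 'M[int]_n).
Hypotheses (cartanC : is_cartan C) (finW : finite_set (W C)).

Implicit Types (i j k : 'I_n) (w v u : 'M[int]_n).
Implicit Types (b x y : 'cV[int]_n) (A J K : {set 'I_n}).

(** The standard inner product summed over the finite group: this makes it invariant, while it stays
    integral and positive definite. *)
Definition gram : 'M[int]_n := \sum_(w \in W C) w^T *m w.
Definition form x y : int := (x^T *m gram *m y) 0 0.

Lemma gram_inv u : W C u -> u^T *m gram *m u = gram.
Proof.
move=> Wu; have Uu := WJ_unit cartanC Wu.
have [Vu WVu] : W C (invmx u) /\ forall w, W C w -> W C (w *m u).
  by split=> [|w Ww]; [apply: WJV | apply: WJM].
have bij : set_bij (W C) (W C) (mulmxr u).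
  split=> [w|w v _ _ /=|w Ww]; first exact: WVu.
    by move=> /(congr1 (mulmxr (invmx u))) /=; rewrite !mulmxK.
  by exists (w *m invmx u) => /=; [apply: WJM | rewrite mulmxKV].
rewrite {2}/gram (reindex_fsbig (mulmxr u) (W C)) //.
rewrite /gram !fsbig_finite // mulmx_sumr mulmx_suml; apply: eq_bigr => w _ /=.
by rewrite trmx_mul !mulmxA.
Qed.

Lemma gram_sym : gram^T = gram.
Proof.
rewrite /gram fsbig_finite // linear_sum; apply: eq_bigr => w _ /=.
by rewrite trmx_mul trmxK.
Qed.

Lemma gramC i j : gram i j = gram j i.
Proof. by rewrite -{1}gram_sym mxE. Qed.

Lemma formC x y : form x y = form y x.
Proof.
rewrite /form (_ : x^T *m _ *m _ = (y^T *m gram *m x)^T); first by rewrite mxE.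
by rewrite !trmx_mul trmxK gram_sym mulmxA.
Qed.

Lemma formZD c x y z : form (c *: x + y) z = c * form x z + form y z.
Proof.
by rewrite /form linearP /= !mulmxDl -!scalemxAl [LHS]mxE [X in X + _]mxE.
Qed.

Lemma formD x y z : form (x + y) z = form x z + form y z.
Proof. by have := formZD 1 x y z; rewrite scale1r mul1r. Qed.

Lemma formZ c x z : form (c *: x) z = c * form x z.
Proof.
have := formZD c x 0 z; rewrite addr0 => ->.
by rewrite [form 0 z](_ : _ = 0) ?addr0 // /form trmx0 !mul0mx mxE.
Qed.

Lemma form_W u x y : W C u -> form (u *m x) (u *m y) = form x y.
Proof.
move=> Wu; rewrite /form trmx_mul -!mulmxA [gram *m _]mulmxA [u^T *m _]mulmxA.
by rewrite [u^T *m (_ *m _)]mulmxA gram_inv.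
Qed.

Lemma form_gt0 x : x <> 0 -> 0 < form x x.
Proof.
move=> x0; rewrite /form /gram fsbig_finite //.
rewrite mulmx_sumr mulmx_suml summxE.
have sq (y : 'cV[int]_n) : (y^T *m y) 0 0 = \sum_i y i 0 ^+ 2.
  by rewrite mxE; apply: eq_bigr => i _; rewrite mxE.
have E w : (x^T *m (w^T *m w) *m x) 0 0 = \sum_i (w *m x) i 0 ^+ 2.
  by rewrite -sq trmx_mul !mulmxA.
have W1 : 1%:M \in fset_set (W C) by rewrite in_fset_set // inE; apply: WJ1.
rewrite (big_fsetD1 _ W1) /= ltr_pwDl //.
  rewrite E mul1mx lt0r sumr_ge0 => [|i _]; last exact: sqr_ge0.
  rewrite andbT psumr_neq0 => [|i _]; last exact: sqr_ge0.
  apply/hasP; apply: contrapT => H; apply: x0; apply/matrixP => i j.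
  rewrite ord1 mxE; apply/eqP; apply: contrapT => xi; apply: H; exists i.
    by rewrite mem_index_enum.
  by rewrite /= lt0r sqr_ge0 andbT sqrf_eq0; apply/negP.
by apply: sumr_ge0 => w _; rewrite E; apply: sumr_ge0 => i _; apply: sqr_ge0.
Qed.

Lemma form_sroot i j : form (sroot i) (sroot j) = gram i j.
Proof.
by rewrite /form -mulmxA /sroot -colE trmx_delta -rowE !mxE.
Qed.

Lemma gram_gt0 i : 0 < gram i i.
Proof. by rewrite -form_sroot; apply: form_gt0; apply: (root_neq0 cartanC (sroot_root C i)). Qed.

(** Obtained by expanding the invariance of [form (sroot i) (sroot j)] under [sref C i], which
    negates [sroot i]. *)
Lemma cartan_gram i j : C i j * gram i i = 2 * gram i j.
Proof.
have Ws : W C (sref C i) by apply: WJs; rewrite inE.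
have := form_W (sroot i) (sroot j) Ws; rewrite (sref_sroot cartanC) sref_mulE.
rewrite coroot_sroot formC addrC -scaleNr formZD ![form _ (- sroot i)]formC.
by rewrite -scaleN1r !formZ !form_sroot; lia.
Qed.

Lemma gram_le0 i j : i != j -> gram i j <= 0.
Proof.
have [_ [C0 _]] := cartanC; move=> /C0.
have := cartan_gram i j; have := gram_gt0 i; nia.
Qed.

Lemma gram_sep i j : C i j = 0 -> gram i j = 0.
Proof. by move=> C0; have := cartan_gram i j; rewrite C0 mul0r; lia. Qed.

Lemma formE x y : form x y = \sum_i \sum_j x i 0 * gram i j * y j 0.
Proof.
rewrite /form mxE exchange_big; apply: eq_bigr => j _ /=.
by rewrite mxE mulr_suml; apply: eq_bigr => i _; rewrite mxE.
Qed.

Lemma form_srootl i x : form (sroot i) x = \sum_j gram i j * x j 0.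
Proof.
rewrite formE (bigD1 i) //= [X in _ + X]big1 ?addr0.
  by apply: eq_bigr => j _; rewrite !mxE !eqxx mul1r.
by move=> j /negPf ji; rewrite big1 // => k _; rewrite !mxE ji !mul0r.
Qed.

Lemma coroot_gram i x : coroot C i x * gram i i = 2 * form (sroot i) x.
Proof.
rewrite /coroot mulr_suml form_srootl mulr_sumr; apply: eq_bigr => j _.
by rewrite mulrAC cartan_gram mulrA.
Qed.

(* The vectors whose coordinates are integral with respect to both the simple
   roots and the simple coroots, coroots being scaled to the length of
   [sroot i]; on this lattice the form divided by [gram i i] is an integral
   quadratic form. *)
Definition colattice i x : Prop := forall j, (gram i i %| (x j 0 * gram j j)%R)%Z.

(** By induction on a word: [sref C k] changes only the coordinate [k], by [coroot C k x], and
    [coroot C k x * gram k k] is a sum of terms [C l k * (x l 0 * gram l l)], all divisible by the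
    induction hypothesis. *)
Lemma colattice_root w i : W C w -> colattice i (w *m sroot i).
Proof.
move=> Ww; move: w Ww; apply: WJ_ind => [|k w _ _ IH].
  move=> j; rewrite mul1mx !mxE; have [->|_] := eqVneq j i; rewrite ?mul0r ?dvdz0 //.
  by rewrite mul1r dvdzz.
move=> j; rewrite -mulmxA; have [->|jk] := eqVneq j k; last by rewrite sref_coord.
rewrite sref_mulE; move: (w *m _) IH => x IH.
rewrite !mxE !eqxx mulr1 mulrBl rpredB //.
rewrite coroot_gram form_srootl mulr_sumr; apply: rpred_sum => l _.
have -> : 2 * (gram k l * x l 0) = C l k * (x l 0 * gram l l).
  have := cartan_gram l k; rewrite (gramC l) => e.
  by rewrite mulrA -e; ring.
exact: dvdz_mull.
Qed.

Lemma colattice_form i x y :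
  colattice i x -> colattice i y -> (gram i i %| 2 * form x y)%Z.
Proof.
move=> Lx Ly; rewrite formE big_distrr; apply: rpred_sum => k _ /=.
rewrite big_distrr; apply: rpred_sum => l _ /=.
have -> : 2 * (x k 0 * gram k l * y l 0) = C k l * y l 0 * (x k 0 * gram k k).
  transitivity (C k l * gram k k * (x k 0 * y l 0)); last by ring.
  by rewrite cartan_gram; ring.
exact: dvdz_mull.
Qed.

(** Splitting [x] into its simple-root components, the diagonal terms are divisible because each
    [x j 0 * gram j j] is, and the doubled cross terms are by [colattice_form]. *)
Lemma colattice_sq i x : colattice i x -> (gram i i %| form x x)%Z.
Proof.
move=> Lx; have Dx := sum_sroot x.
suff [] : colattice i (\sum_j x j 0 *: sroot j) /\
  (gram i i %| form (\sum_j x j 0 *: sroot j) (\sum_j x j 0 *: sroot j))%Z by rewrite -Dx.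
apply: (big_ind (fun y => colattice i y /\ (gram i i %| form y y)%Z)).
- split=> [j|]; first by rewrite mxE mul0r dvdz0.
  by rewrite formE big1 ?dvdz0 // => k _; rewrite big1 // => l _; rewrite !mxE !mul0r.
- move=> y z [Ly qy] [Lz qz]; split=> [j|]; first by rewrite mxE mulrDl rpredD // ?Ly ?Lz.
  have -> : form (y + z) (y + z) = form y y + 2 * form y z + form z z.
    by rewrite formD ![form _ (y + z)]formC !formD [form z y]formC; ring.
  by rewrite !rpredD // colattice_form.
- move=> j _; split=> [k|].
    by rewrite !mxE; have [->|_] := eqVneq k j; rewrite ?mulr0 ?mul0r ?dvdz0 // mulr1 Lx.
  rewrite formZ formC formZ form_sroot dvdz_mull //; exact: Lx.
Qed.

Definition trunc A x : 'cV[int]_n := \col_i (if i \in A then x i 0 else 0).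

(* Otherwise both truncations, lying in the lattice, have norm at least
   [gram i i], the norm of [b], which would then be at least twice itself. *)
Lemma root_trunc b A : roots C b -> trunc A b <> 0 -> trunc (~: A)%SET b <> 0 ->
  form (trunc A b) (trunc (~: A)%SET b) < 0.
Proof.
move=> [w [i [Ww eb]]] /form_gt0 nA /form_gt0 nB.
have Lb : colattice i b by rewrite eb; apply: colattice_root.
have Lt B : colattice i (trunc B b).
  by move=> j; rewrite mxE; case: ifP; rewrite ?mul0r ?dvdz0.
have fb : form b b = gram i i by rewrite eb form_W // form_sroot.
have eb' : b = trunc A b + trunc (~: A)%SET b.
  apply/matrixP => k l; rewrite ord1 !mxE finset.in_setC.
  by case: ifP => /= _; rewrite ?addr0 ?add0r.
have : form b b = form (trunc A b) (trunc A b) + 2 * form (trunc A b) (trunc (~: A)%SET b)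
   + form (trunc (~: A)%SET b) (trunc (~: A)%SET b).
  rewrite {1 2}eb' formD ![form _ (_ + _)]formC !formD.
  by rewrite [form (trunc (~: A)%SET b) (trunc A b)]formC; ring.
have dv B : 0 < form (trunc B b) (trunc B b) -> gram i i <= form (trunc B b) (trunc B b).
  move=> pos; have /dvdzP[c e] := colattice_sq (Lt B).
  have g0 := gram_gt0 i; move: pos; rewrite e pmulr_lgt0 // => c0.
  by rewrite -{1}[gram i i]mul1r ler_wpM2r // ltW.
have := dv _ nA; have := dv _ nB; have := gram_gt0 i; rewrite fb; lia.
Qed.

End Form.

(** * Positive and negative roots *)

Section Roots.
Variables (n : nat) (C : 'M[int]_n).
Hypotheses (cartanC : is_cartan C) (finW : finite_set (W C)).

Implicit Types (i j k : 'I_n) (w v u : 'M[int]_n) (s t : seq 'I_n).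
Implicit Types (b x y : 'cV[int]_n) (A J K : {set 'I_n}).

Notation pos := (pos_roots C).

Definition supp x : {set 'I_n} := [set i | x i 0 != 0]%SET.

Lemma supp_span A x : spanJ A x <-> supp x \subset A.
Proof.
split=> [xA|/fintype.subsetP xA i iA].
  by apply/fintype.subsetP => i; rewrite finset.inE; apply: contraNT => /xA ->.
by apply/eqP; apply: contraNT iA => xi; apply: xA; rewrite finset.inE.
Qed.

(** Otherwise the truncations of [b] to [A] and to its complement are orthogonal, against
    [root_trunc]. *)
Lemma root_cut b A : roots C b -> A \subset supp b -> A != finset.set0 -> A != supp b ->
  exists i j, [/\ i \in A, j \in supp b, j \notin A & C i j != 0].
Proof.
move=> rb AS A0 AS'; apply: contrapT => H.
have : form C (trunc A b) (trunc (~: A)%SET b) < 0.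
  apply: root_trunc => //.
    move=> /matrixP e; have /finset.set0Pn[i iA] := A0.
    have := e i 0; rewrite !mxE iA => /eqP.
    by apply/negP; have := fintype.subsetP AS _ iA; rewrite finset.inE.
  move=> /matrixP e; case/negP: AS'; rewrite finset.eqEsubset AS /=.
  apply/fintype.subsetP => i; rewrite finset.inE; apply: contraNT => iA.
  by have := e i 0; rewrite !mxE finset.in_setC iA => ->.
rewrite formE big1 ?ltxx // => i _; rewrite big1 // => j _; rewrite !mxE finset.in_setC.
case: ifP => iA; rewrite ?mul0r //; case: ifP => [/negP/negP jA|_]; rewrite ?mulr0 //.
have [->|bj] := eqVneq (b j 0) 0; rewrite ?mulr0 //.
have [C0|C0] := eqVneq (C i j) 0; first by rewrite (gram_sep cartanC) // mulr0 mul0r.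
by case: H; exists i, j; split=> //; rewrite finset.inE.
Qed.

(** Cut [b] along its positive coordinates. If both parts were nonzero, their form would be
    nonnegative, since coordinates of opposite signs meet off-diagonal Gram entries that are at most
    0; this contradicts [root_trunc]. *)
Lemma root_sign b : roots C b -> pos b \/ pos (- b).
Proof.
move=> rb; set A := [set i | 0 < b i 0]%SET.
have [tA|tA] := pselect (trunc A b = 0).
  right; split; first exact: rootsN.
  move=> i; rewrite mxE oppr_ge0 leNgt; apply/negP => bi.
  by have := congr1 (fun x => x i 0) tA; rewrite !mxE finset.inE bi => e; move: bi; rewrite e.
have [tB|tB] := pselect (trunc (~: A)%SET b = 0).
  left; split=> // i; rewrite leNgt; apply/negP => bi.
  have := congr1 (fun x => x i 0) tB; rewrite !mxE !finset.inE ltNge ltW //= => e.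
  by move: bi; rewrite e.
have := root_trunc cartanC finW rb tA tB; rewrite ltNge => /negP; case.
rewrite formE; apply: sumr_ge0 => i _; apply: sumr_ge0 => j _; rewrite !mxE !finset.inE.
case: ltP => bi; rewrite ?mul0r //; case: ltP => bj /=; rewrite ?mulr0 //.
rewrite mulr_le0 // pmulr_rle0 //; apply: gram_le0 => //.
by apply: contraTneq bi => ->; rewrite -leNgt.
Qed.

Lemma pos_notN b : pos b -> ~ pos (- b).
Proof.
move=> [rb b0] [_ bN]; apply: (root_neq0 cartanC rb).
apply/matrixP => i j; rewrite ord1 mxE; apply/eqP; rewrite eq_le b0 andbT.
by have := bN i; rewrite mxE oppr_ge0.
Qed.

Lemma pos_sroot i : pos (sroot i).
Proof. by split; [apply: sroot_root | move=> j; rewrite !mxE; case: (_ && _)]. Qed.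

Lemma pos_coord b i : roots C b -> 0 < b i 0 -> pos b.
Proof.
by move=> rb bi; have [//|[_ /(_ i)]] := root_sign rb; rewrite mxE oppr_ge0 leNgt bi.
Qed.

Lemma pos_comb w A : W C w -> (forall i, i \in A -> pos (w *m sroot i)) ->
  forall b, pos b -> spanJ A b -> pos (w *m b).
Proof.
move=> Ww wA b [rb b0] bA; split=> [|k]; first exact: roots_W.
rewrite [b]sum_sroot mulmx_sumr summxE; apply: sumr_ge0 => i _.
rewrite -scalemxAr mxE; have [iA|iA] := boolP (i \in A); last by rewrite bA // mul0r.
by apply: mulr_ge0 => //; have [_] := wA i iA.
Qed.

Lemma pos_line i b : pos b -> (forall k, k != i -> b k 0 = 0) -> b = sroot i.
Proof.
move=> [rb b0] bk; have eb : b = b i 0 *: sroot i.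
  apply/matrixP => k l; rewrite ord1 !mxE eqxx andbT.
  by have [->|ki] := eqVneq k i; rewrite ?mulr1 // mulr0 bk.
have := root_primitive cartanC rb eb; have := b0 i => bi0; move: eb bi0.
move: (b i 0) => c -> c0 cu; suff -> : c = 1 by rewrite scale1r.
by move: cu c0; rewrite unitrE; lia.
Qed.

(** [sref C i] alters only the coordinate [i]; a positive root other than [sroot i] has another
    positive coordinate, and one positive coordinate makes a root positive. *)
Lemma sref_pos i b : pos b -> b <> sroot i -> pos (sref C i *m b).
Proof.
move=> [rb b0] bi; have rsb : roots C (sref C i *m b).
  by apply: roots_W => //; apply: WJs; rewrite finset.inE.
have [[k ki bk]|H] := pselect (exists2 k, k != i & b k 0 != 0).
  by apply: (pos_coord (i := k)) => //; rewrite sref_coord // lt0r bk b0.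
case: bi; apply: pos_line => // k ki; apply/eqP; apply: contrapT => /negP bk.
by apply: H; exists k.
Qed.

Definition negr x : bool := `[< pos (- x) >].

Lemma negrN x : roots C x -> negr (- x) = ~~ negr x.
Proof.
move=> rx; rewrite /negr opprK; apply/idP/idP => [/asboolP px|/asboolPn nx].
  by apply/asboolPn; apply: pos_notN.
by apply/asboolP; have [] := root_sign rx.
Qed.

Lemma negrPn x : roots C x -> ~~ negr x -> pos x.
Proof. by move=> rx /asboolPn nx; have [] := root_sign rx. Qed.

Lemma negr_pos x : pos x -> negr x = false.
Proof. by move=> px; apply/asboolPn; apply: pos_notN. Qed.

Lemma negr_sref i x : roots C x -> x <> sroot i -> x <> - sroot i ->
  negr (sref C i *m x) = negr x.
Proof.
move=> rx xi xNi; have [px|nx] := root_sign rx.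
  by rewrite !negr_pos //; apply: sref_pos.
have sNx : pos (sref C i *m - x).
  by apply: sref_pos => // e; apply: xNi; rewrite -e opprK.
by rewrite -[x]opprK mulmxN (negrN sNx.1) (negrN nx.1) !negr_pos.
Qed.

(** * Counting inversions *)

Lemma finite_pos : finite_set pos.
Proof.
have := finite_image2 (fun w i => w *m (sroot i : 'cV[int]_n)) finW (@finite_finset _ [set: 'I_n]).
apply: sub_finite_set => _ [[w [i [Ww ->]]] _]; exists w => //; by exists i.
Qed.

Definition posl : seq 'cV[int]_n := fset_set pos.

Lemma mem_posl b : (b \in posl) = `[< pos b >].
Proof. by rewrite in_fset_set ?inE //; apply: finite_pos. Qed.

Lemma posl_uniq : uniq posl.
Proof. exact: finmap.fset_uniq. Qed.

Definition ninv w : nat := count (fun b => negr (w *m b)) posl.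

Lemma count_switch (T : eqType) (a c : pred T) (l : seq T) z : uniq l -> z \in l ->
  ~~ a z -> c z -> {in l, forall z', z' != z -> a z' = c z'} ->
  count c l = (count a l).+1.
Proof.
move=> ul zl az cz H; rewrite (permP (perm_to_rem zl) c) (permP (perm_to_rem zl) a) /=.
rewrite (negPf az) cz add0n add1n; congr _.+1; apply: eq_in_count => z'.
by rewrite mem_rem_uniq // => /andP[zz' zl']; rewrite H.
Qed.

(** Only the root [invmx w *m sroot i] changes status, because [sref C i] preserves the sign of
    every root except [sroot i] and its negative. *)
Lemma ninv_sref_pos w i : W C w -> pos (invmx w *m sroot i) ->
  ninv (sref C i *m w) = (ninv w).+1.
Proof.
move=> Ww pb; set b := invmx w *m _ in pb.
have wb : w *m b = sroot i by rewrite mulKVmx ?(WJ_unit cartanC Ww).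
apply: (count_switch (z := b)); rewrite ?posl_uniq ?mem_posl //.
- exact/asboolP.
- by rewrite wb negr_pos //; apply: pos_sroot.
- by rewrite -mulmxA wb sref_sroot // /negr opprK; apply/asboolP; apply: pos_sroot.
move=> y; rewrite mem_posl => /asboolP py yb; rewrite -mulmxA negr_sref //.
- by apply: roots_W => //; case: py.
- move=> e; move: yb; rewrite /b -e mulKmx ?eqxx // (WJ_unit cartanC Ww) //.
- move=> e; apply: (pos_notN pb); rewrite /b -mulmxN -e mulKmx //.
  exact: (WJ_unit cartanC Ww).
Qed.

Lemma ninv_sref_neg w i : W C w -> pos (- (invmx w *m sroot i)) ->
  ninv w = (ninv (sref C i *m w)).+1.
Proof.
move=> Ww pb.
have Wsw : W C (sref C i *m w) by apply: WJM => //; apply: W_sref.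
have e : w = sref C i *m (sref C i *m w) by rewrite mulmxA sref_invol // mul1mx.
have eV : invmx (sref C i *m w) *m sroot i = - (invmx w *m sroot i).
  by rewrite (W_invM cartanC (W_sref C i) Ww) sref_inv // -mulmxA sref_sroot // mulmxN.
by rewrite {1}e ninv_sref_pos // eV.
Qed.

End Roots.

(** * Length and inversions *)

Section Length.
Variables (n : nat) (C : 'M[int]_n).
Hypotheses (cartanC : is_cartan C) (finW : finite_set (W C)).

Implicit Types (i j k : 'I_n) (w v u : 'M[int]_n) (s t : seq 'I_n).
Implicit Types (b : 'cV[int]_n) (A J K : {set 'I_n}).

Notation pos := (pos_roots C).
Notation negr := (negr C).
Notation ninv := (ninv C).
Notation posl := (posl C).

Lemma ninv1 : ninv 1%:M = 0%N.
Proof.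
apply/eqP; rewrite eqn0Ngt -has_count; apply/hasPn => b.
by rewrite (mem_posl finW) mul1mx => /asboolP pb; rewrite (negr_pos cartanC).
Qed.

(** An element of [W] preserves the form, hence carries the coroot functional of [sroot i] to that
    of its image. *)
Lemma reflection_conj u i j : W C u -> u *m sroot i = sroot j ->
  u *m sref C i *m invmx u = sref C j.
Proof.
move=> Wu e; have Uu := WJ_unit cartanC Wu; apply: mulmx_cV_inj => x.
rewrite -!mulmxA !sref_mulE mulmxBr mulKVmx // -scalemxAr e; congr (_ - _ *: _).
have ij : gram C i i = gram C j j.
  by rewrite -!form_sroot -e form_W.
have := gram_gt0 cartanC finW i => /lt0r_neq0 /mulIf; apply.
by rewrite {2}ij !coroot_gram // -(form_W cartanC finW _ _ Wu) e mulKVmx.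
Qed.

(* Strong exchange: [u *m sref C i *m invmx u] is the reflection in the root
   [u *m sroot i]. *)
Lemma exchange t u i : W C u -> pos (u *m sroot i) ->
  pos (- (invmx (word_elt C t) *m (u *m sroot i))) ->
  exists t', (size t').+1 = size t /\
    u *m sref C i *m invmx u *m word_elt C t = word_elt C t'.
Proof.
elim: t u => [|j t IH] u Wu pb /=.
  by rewrite invmx1 mul1mx => /(pos_notN cartanC pb).
rewrite (W_invM cartanC (W_sref C j) (W_word C t)) sref_inv // -mulmxA => nb.
(* If the root is [sroot j], the reflection cancels the first letter. Otherwise [sref C j] keeps the
   root positive and the letter to delete lies further on. *)
have [e|e] := pselect (u *m sroot i = sroot j).
  exists t; split=> //; rewrite (reflection_conj Wu e) mulmxA sref_invol //.
  by rewrite mul1mx.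
have Wsu : W C (sref C j *m u) by apply: WJM => //; apply: W_sref.
have [] := IH _ Wsu; rewrite -?mulmxA //; first exact: sref_pos.
move=> t' [st et]; exists (j :: t'); split; first by rewrite /= st.
rewrite /= -et (W_invM cartanC (W_sref C j) Wu) sref_inv // !mulmxA sref_invol //.
by rewrite mul1mx.
Qed.

Lemma ninv_sref_cases w i : W C w ->
  ninv (sref C i *m w) = (ninv w).+1 \/
  pos (- (invmx w *m sroot i)) /\ ninv w = (ninv (sref C i *m w)).+1.
Proof.
move=> Ww; have rb : roots C (invmx w *m sroot i).
  by apply: roots_W => //; [apply: WJV | apply: sroot_root].
have [pb|pb] := root_sign cartanC finW rb; first by left; apply: ninv_sref_pos.
by right; split=> //; apply: ninv_sref_neg.
Qed.

Lemma ninv_word s : (ninv (word_elt C s) <= size s)%N.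
Proof.
elim: s => [|i s IH] /=; first by rewrite ninv1.
by have := ninv_sref_cases i (W_word C s) => -[->|[_ e]] //; lia.
Qed.

(** Either the tail already has too few inversions, or it has as many as letters and the first
    letter lowers that number; then [exchange] with [u = 1] absorbs the first letter and deletes one
    of the tail. *)
Lemma deletion s : (ninv (word_elt C s) < size s)%N ->
  exists2 t, (size t < size s)%N & word_elt C t = word_elt C s.
Proof.
elim: s => //= i s IH lt.
have := ninv_word s; rewrite leq_eqVlt => /orP[/eqP e|/IH[t lts et]]; last first.
  by exists (i :: t) => //=; rewrite et.
have [H|[nb _]] := ninv_sref_cases i (W_word C s); first by move: lt; rewrite H e ltnn.
have := @exchange s 1%:M i; rewrite !mul1mx => /(_ (WJ1 _ _) (pos_sroot _ _) nb).
move=> [t [st et]]; exists t; first by rewrite -st; lia.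
by rewrite -et invmx1 mulmx1.
Qed.

Lemma ell_spec w : W C w -> (exists s, size s = ell C w /\ w = word_elt C s) /\
  (forall s, w = word_elt C s -> (ell C w <= size s)%N).
Proof.
move=> [s0 [_ e0]].
have ex : exists m, `[< exists s, size s = m /\ w = word_elt C s >].
  by exists (size s0); apply/asboolP; exists s0.
rewrite /ell; apply: (@xgetPex _ _ [set m | (exists s, size s = m /\ w = word_elt C s) /\
  forall s, w = word_elt C s -> (m <= size s)%N]).
exists (ex_minn ex); case: ex_minnP => k /asboolP[s [sk es]] H; split; first by exists s.
by move=> t et; apply: H; apply/asboolP; exists t.
Qed.

(** A letter creates at most one inversion, and a shortest word with more letters than inversions
    could be shortened by [deletion]. *)
Lemma ell_ninv w : W C w -> ell C w = ninv w.
Proof.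
move=> Ww; have [[s [ss es]] mins] := ell_spec Ww.
have le : (ninv w <= ell C w)%N by rewrite -ss es ninv_word.
apply/eqP; rewrite eqn_leq le andbT leqNgt; apply/negP => lt.
have [|t lt' et] := @deletion s; first by rewrite -es ss.
by have := mins t; rewrite et -es -ss => /(_ erefl); rewrite leqNgt lt'.
Qed.

Lemma ell1 : ell C 1%:M = 0%N.
Proof. by rewrite ell_ninv ?ninv1 //; apply: WJ1. Qed.

Lemma ellV w : W C w -> ell C (invmx w) = ell C w.
Proof.
suff le v : W C v -> (ell C (invmx v) <= ell C v)%N.
  move=> Ww; apply/eqP; rewrite eqn_leq le //=.
  by have := le _ (WJV cartanC Ww); rewrite invmxK.
move=> Wv; have [[s [<- es]] _] := ell_spec Wv.
have [_ H] := ell_spec (WJV cartanC Wv).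
by rewrite -(size_rev s); apply: H; rewrite es word_inv.
Qed.

Lemma pos_id w : W C w -> (forall b, pos b -> pos (w *m b)) -> w = 1%:M.
Proof.
move=> Ww H; have [[s [ss es]] _] := ell_spec Ww.
suff e0 : ell C w = 0%N by rewrite es; case: s ss es => //; rewrite e0.
rewrite ell_ninv //; apply/eqP; rewrite eqn0Ngt -has_count; apply/hasPn => b.
by rewrite (mem_posl finW) => /asboolP /H pb; rewrite (negr_pos cartanC pb).
Qed.

(** As long as [invmx y] makes some simple root of [A] negative, multiplying [y] on the left by that
    reflection lowers the number of inversions; when none is left, positivity extends to all
    positive roots in the span. *)
Lemma parabolic_rep A y : W C y -> exists x, WJ C A x /\
  forall b, pos b -> spanJ A b -> pos (invmx (x *m y) *m b).
Proof.
have [m] := ubnP (ninv y); elim: m y => // m IH y lt Wy.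
have [H|H] := pselect (forall i, i \in A -> pos (invmx y *m sroot i)).
  exists 1%:M; split=> [|b pb bA]; first exact: WJ1.
  by rewrite mul1mx; apply: (pos_comb _ H) => //; apply: WJV.
have [i [iA np]] : exists i, i \in A /\ ~ pos (invmx y *m sroot i).
  by apply: contrapT => N; apply: H => i iA; apply: contrapT => np; apply: N; exists i.
have rb : roots C (invmx y *m sroot i).
  by apply: roots_W => //; [apply: WJV | apply: sroot_root].
have [//|nb] := root_sign cartanC finW rb.
have e := ninv_sref_neg cartanC finW Wy nb.
have Wsy : W C (sref C i *m y) by apply: WJM => //; apply: W_sref.
have [|x [Ax Hx]] := IH _ _ Wsy; first by rewrite e in lt.
exists (x *m sref C i); split; first by apply: WJM => //; apply: WJs.
by rewrite -mulmxA.
Qed.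

Lemma parabolic_decomp A w : W C w -> exists x, WJ C A x /\
  forall b, pos b -> spanJ A b -> pos (w *m invmx x *m b).
Proof.
move=> Ww; have Wv := WJV cartanC Ww.
have [x [Ax Hx]] := parabolic_rep A Wv; exists x; split=> // b pb bA.
by have := Hx b pb bA; rewrite (W_invM cartanC (WJW Ax) Wv) invmxK.
Qed.

Lemma invE w b : inv C w b <-> pos b /\ negr (w *m b).
Proof. by rewrite /inv /negr /=; split=> -[? /asboolP]. Qed.

Lemma WJ_inv_span A w : WJ C A w -> forall b, inv C w b -> spanJ A b.
Proof.
move=> Aw b [pb nb] k kA; have := nb.2 k; rewrite [X in 0 <= X]mxE.
by rewrite (WJ_coord Aw) // oppr_ge0 => le; apply: le_anti; rewrite le pb.2.
Qed.

(** The factor [x] of [parabolic_decomp] works: [w *m invmx x] preserves the signs of the roots in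
    the span of [A], so [w] and [x] give the same sign to each of them. *)
Lemma restr_exists A w : W C w -> exists x, WJ C A x /\
  inv C x `&` spanJ A = inv C w `&` spanJ A.
Proof.
move=> Ww; have [x [Ax Hx]] := parabolic_decomp A Ww; exists x; split=> //.
have Ux := WJ_unit cartanC Ax.
have e b : w *m b = w *m invmx x *m (x *m b) by rewrite mulmxA mulmxKV.
have key b : pos b -> spanJ A b -> (pos (- (x *m b)) <-> pos (- (w *m b))).
  move=> pb bA; have xbA := WJ_span Ax bA.
  have [p|p] := root_sign cartanC finW (roots_W (WJW Ax) pb.1).
    split=> H; first by case: (pos_notN cartanC p).
    by rewrite e in H; case: (pos_notN cartanC (Hx _ p xbA)).
  split=> // _; rewrite e -mulmxN; apply: Hx => // k /xbA xk.
  by rewrite [LHS]mxE xk oppr0.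
by apply/seteqP; split=> b [[pb nb] bA]; split=> //; split=> //; apply/key.
Qed.

(** * Left weak order in terms of lengths *)

Definition absr (b : 'cV[int]_n) := if negr b then - b else b.

Lemma absr_pos b : roots C b -> pos (absr b).
Proof.
move=> rb; rewrite /absr; case: ifPn => [/asboolP //|nb].
exact: (negrPn cartanC finW).
Qed.

Lemma absr_perm w : W C w -> perm_eq [seq absr (w *m b) | b <- posl] posl.
Proof.
move=> Ww; have Uw := WJ_unit cartanC Ww.
have us : uniq [seq absr (w *m b) | b <- posl].
  rewrite map_inj_in_uniq ?posl_uniq // => b b'.
  rewrite !(mem_posl finW) => /asboolP pb /asboolP pb'; rewrite /absr.
  case: (negr _); case: (negr _).
  - by move=> /oppr_inj; apply: (can_inj (mulKmx Uw)).
  - rewrite -mulmxN => /(can_inj (mulKmx Uw)) e.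
    by case: (pos_notN cartanC pb); rewrite e.
  - rewrite -mulmxN => /(can_inj (mulKmx Uw)) e.
    by case: (pos_notN cartanC pb'); rewrite -e.
  - exact: (can_inj (mulKmx Uw)).
have sub : {subset [seq absr (w *m b) | b <- posl] <= posl}.
  move=> _ /mapP[b + ->]; rewrite !(mem_posl finW) => /asboolP pb.
  by apply/asboolP/absr_pos/roots_W => //; case: pb.
have [_ e] := uniq_min_size us sub (eq_leq (esym (size_map _ _))).
exact: uniq_perm us (posl_uniq _) e.
Qed.

(** Reindexing by the permutation [absr (v *m b)] of the positive roots leaves the roots to which
    [v] and [w] give different signs, that is, the symmetric difference of the inversion sets. *)
Lemma ninv_divE v w : W C v -> W C w ->
  ninv (w *m invmx v) = count (fun b => negr (v *m b) (+) negr (w *m b)) posl.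
Proof.
move=> Wv Ww; rewrite /ninv -(permP (absr_perm Wv)) count_map.
apply: eq_in_count => b; rewrite (mem_posl finW) => /asboolP[rb _] /=.
have Uv := WJ_unit cartanC Wv; rewrite /absr; case: ifPn => nb.
  rewrite mulmxN -mulmxA mulKmx // (negrN cartanC finW) //.
  exact: roots_W.
by rewrite -mulmxA mulKmx.
Qed.

Lemma count_addb (T : Type) (a c : pred T) (l : seq T) :
  (count a l + count (fun z => a z (+) c z) l =
   count c l + (count (fun z => a z && ~~ c z) l).*2)%N.
Proof. by elim: l => //= z l; case: (a z); case: (c z) => /=; lia. Qed.

(** By [ninv_divE] and [count_addb], the defect in additivity is twice the number of inversions of
    [v] that are not inversions of [w]. *)
Lemma leL_ell v w : W C v -> W C w ->
  leL C v w <-> (ell C (w *m invmx v) + ell C v = ell C w)%N.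
Proof.
move=> Wv Ww; rewrite !ell_ninv //; last by apply: WJM => //; apply: WJV.
rewrite ninv_divE // addnC.
have := count_addb (fun b => negr (v *m b)) (fun b => negr (w *m b)) posl.
rewrite -/(ninv v) -/(ninv w) => ->.
split=> [H|/eqP]; last first.
  rewrite -[X in _ == X]addn0 eqn_add2l double_eq0 eqn0Ngt -has_count => /hasPn H b.
  move=> /invE[pb vb]; apply/invE; split=> //; have := H b.
  by rewrite (mem_posl finW) vb negbK; apply; apply/asboolP.
rewrite [count _ _](_ : _ = 0%N) ?addn0 //; apply/eqP; rewrite eqn0Ngt -has_count.
apply/hasPn => b; rewrite (mem_posl finW) => /asboolP pb.
apply/negP => /andP[vb /negP]; apply.
by have [] : pos b /\ negr (w *m b) by apply/invE/H/invE.
Qed.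

(** Inclusion both ways forces [w *m invmx v] to have length 0, by [leL_ell]. *)
Lemma inv_inj v w : W C v -> W C w -> inv C v = inv C w -> v = w.
Proof.
move=> Wv Ww e; have Uv := WJ_unit cartanC Wv.
have Wu : W C (w *m invmx v) by apply: WJM => //; apply: WJV.
have : leL C v w by move=> b; rewrite e.
have : leL C w v by move=> b; rewrite e.
move=> /(leL_ell Ww Wv) + /(leL_ell Wv Ww) => e1 e2.
have : ell C (w *m invmx v) = 0%N by lia.
have [[s [<- es]] _] := ell_spec Wu; move=> /size0nil s0.
by rewrite -[RHS](mulmxKV Uv) es s0 mul1mx.
Qed.

(** Restricting [w] to [A] loses no inversion, so [inv_inj] identifies [w] with its restriction. *)
Lemma inv_sub_WJ A w : W C w -> (forall b, inv C w b -> spanJ A b) -> WJ C A w.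
Proof.
move=> Ww wA; have [x [Ax e]] := restr_exists A Ww.
suff -> : w = x by [].
apply: inv_inj => //; first exact: (WJW Ax).
apply/seteqP; split=> b nb.
  have : (inv C w `&` spanJ A) b by split=> //; apply: wA.
  by rewrite -e => -[].
have : (inv C x `&` spanJ A) b by split=> //; apply: (WJ_inv_span Ax).
by rewrite e => -[].
Qed.

(** * Longest elements of parabolic subgroups *)

Lemma longest_exists J :
  exists w, WJ C J w /\ forall v, WJ C J v -> (ell C v <= ell C w)%N.
Proof.
pose P m := `[< exists w, WJ C J w /\ ell C w = m >].
have exP : exists m, P m.
  by exists (ell C 1%:M); apply/asboolP; exists 1%:M; split=> //; apply: WJ1.
have bnd m : P m -> (m <= size posl)%N.
  by move=> /asboolP[w [Jw <-]]; rewrite ell_ninv ?count_size //; apply: (WJW Jw).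
have [m /asboolP[w [Jw ew]] H] := ex_maxnP exP bnd.
exists w; split=> // v Jv; rewrite ew; apply: H; apply/asboolP; by exists v.
Qed.

Lemma w0_spec J : WJ C J (w0 C J) /\
  forall v, WJ C J v -> (ell C v <= ell C (w0 C J))%N.
Proof.
rewrite /w0; apply: (@xgetPex _ _ [set w | WJ C J w /\
  forall v, WJ C J v -> (ell C v <= ell C w)%N]).
exact: longest_exists.
Qed.

Lemma w0_WJ J : WJ C J (w0 C J).
Proof. by have [] := w0_spec J. Qed.

(** Otherwise [w0 C J *m sref C i] would be longer; the argument passes to inverses because
    inversions are counted under left multiplication. *)
Lemma w0_sroot J i : i \in J -> pos (- (w0 C J *m sroot i)).
Proof.
move=> iJ; have [Jw H] := w0_spec J; have Ww := WJW Jw.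
have Wv := WJV cartanC Ww; have Uw := WJ_unit cartanC Ww.
have [e|[nb _]] := ninv_sref_cases i Wv; last by rewrite invmxK in nb.
have := H _ (WJM Jw (WJs C iJ)).
rewrite -ellV; last exact: (WJW (WJM Jw (WJs C iJ))).
rewrite (W_invM cartanC Ww (W_sref C i)) sref_inv // ell_ninv; last first.
  by apply: WJM => //; apply: W_sref.
by rewrite e -ell_ninv // ellV // ltnn.
Qed.

Lemma w0_neg J b : pos b -> spanJ J b -> pos (- (w0 C J *m b)).
Proof.
move=> [rb b0] bJ; split=> [|k].
  by apply: rootsN => //; apply: roots_W => //; apply: (WJW (w0_WJ J)).
rewrite [b]sum_sroot mulmx_sumr -sumrN summxE; apply: sumr_ge0 => i _.
rewrite -scalemxAr -scalerN mxE; have [iA|iA] := boolP (i \in J); last by rewrite bJ // mul0r.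
by apply: mulr_ge0 => //; have [_] := w0_sroot iA.
Qed.

(** Some coordinate of [b] outside [J] is positive, and [w] leaves it alone. *)
Lemma WJ_pos J w b : WJ C J w -> pos b -> ~ spanJ J b -> pos (w *m b).
Proof.
move=> Jw pb nb; have [k kJ bk] : exists2 k, k \notin J & b k 0 != 0.
  apply: contrapT => H; apply: nb => k kJ; apply/eqP; apply: contrapT => /negP bk.
  by apply: H; exists k.
apply: (pos_coord cartanC finW (i := k)); first exact: (roots_W (WJW Jw) pb.1).
by rewrite (WJ_coord Jw) // lt0r bk pb.2.
Qed.

End Length.

(** * Connected sets of simple roots *)

Section Graph.
Variables (n : nat) (C : 'M[int]_n).

Implicit Types (i j k x y : 'I_n) (A B I J K : {set 'I_n}) (N S : {set {set 'I_n}}).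

Notation adj := (adj C).
Notation conn := (connectedJ C).

Lemma adjC i j : adj i j = adj j i.
Proof. by rewrite /Defs.adj eq_sym [_ *m _ == _]eq_sym. Qed.

Lemma adjE : is_cartan C -> forall i j, adj i j = (i != j) && (C i j != 0).
Proof.
move=> cartanC i j; have [_ [_ C0]] := cartanC; rewrite /Defs.adj; have [//|ij] /= := eqVneq i j.
congr negb; apply/eqP/eqP => [e|Cij].
  (* If the reflections commute, the image of [sroot j] has both [C i j] and [- C i j] as its
     coordinate [i]. *)
  have := congr1 (fun M => (M *m (sroot j : 'cV[int]_n)) i 0) e; rewrite -!mulmxA sref_sroot //.
  have c : (sref C i *m (sroot j : 'cV[int]_n)) i 0 = - C i j.
    by rewrite sref_mulE coroot_sroot !mxE !eqxx (negPf ij) mulr1 sub0r.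
  by rewrite (sref_coord C _ ij) mulmxN [LHS]mxE c; lia.
apply: mulmx_cV_inj => x; rewrite -!mulmxA [sref C j *m x]sref_mulE [sref C i *m x]sref_mulE.
rewrite ![_ *m (x - _)]mulmxBr -!scalemxAr !sref_mulE !coroot_sroot Cij (C0 i j).1 //.
by rewrite !scale0r !subr0 -!addrA; congr (_ + _); rewrite addrC.
Qed.

Lemma edgeJC J : symmetric (edgeJ C J).
Proof. by move=> i j; rewrite /edgeJ adjC; case: (i \in J); case: (j \in J). Qed.

Lemma connectJC J : connect_sym (edgeJ C J).
Proof. exact/sym_connect_sym/edgeJC. Qed.

Lemma conn_neq0 J : conn J -> J != finset.set0.
Proof. by case/andP. Qed.

Lemma conn_connect J x y : conn J -> x \in J -> y \in J -> connect (edgeJ C J) x y.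
Proof. by case/andP=> _ /forallP/(_ x)/implyP H xJ; move/forallP: (H xJ) => /(_ y)/implyP. Qed.

Lemma conn_root J x : x \in J -> (forall y, y \in J -> connect (edgeJ C J) x y) -> conn J.
Proof.
move=> xJ H; apply/andP; split; first by apply/finset.set0Pn; exists x.
apply/forallP => y; apply/implyP => yJ; apply/forallP => z; apply/implyP => zJ.
by apply: connect_trans (H z zJ); rewrite connectJC H.
Qed.

Lemma conn_cut J A : conn J -> A \subset J -> A != finset.set0 -> A != J ->
  exists i j, [/\ i \in A, j \in J, j \notin A & adj i j].
Proof.
move=> cJ AJ /finset.set0Pn[a aA] AnJ; apply: contrapT => H.
case/negP: AnJ; rewrite finset.eqEsubset AJ; apply/fintype.subsetP => b bJ.
have cl : closed (edgeJ C J) (mem A).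
  suff imp x y : edgeJ C J x y -> x \in A -> y \in A.
    by move=> x y e; apply/idP/idP; apply: imp; rewrite // edgeJC.
  move=> /and3P[xJ yJ xy] xA; apply: contrapT => /negP yA; apply: H.
  by exists x, y.
by have := closed_connect cl (conn_connect cJ (fintype.subsetP AJ _ aA) bJ) => /= <-.
Qed.

Lemma cut_conn J : J != finset.set0 ->
  (forall A, A \subset J -> A != finset.set0 -> A != J ->
    exists i j, [/\ i \in A, j \in J, j \notin A & adj i j]) -> conn J.
Proof.
move=> /finset.set0Pn[x xJ] H; apply: (conn_root xJ).
(* The part of [J] reachable from [x]; an edge leaving it would extend it. *)
pose A := [set y in J | connect (edgeJ C J) x y]%SET.
have AJ : A \subset J by apply/fintype.subsetP => y; rewrite finset.inE => /andP[].
have xA : x \in A by rewrite finset.inE xJ connect0.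
have [AeJ|AnJ] := eqVneq A J.
  by move=> y yJ; have : y \in A by [rewrite AeJ]; rewrite finset.inE => /andP[].
have [] := H A AJ _ AnJ; first by apply/finset.set0Pn; exists x.
move=> i [j [iA jJ jA ij]]; case/negP: jA; move: iA; rewrite !finset.inE jJ => /andP[iJ xi].
by apply: connect_trans xi _; apply: connect1; rewrite /edgeJ iJ jJ.
Qed.

Lemma connectJ_sub J K x y : J \subset K ->
  connect (edgeJ C J) x y -> connect (edgeJ C K) x y.
Proof.
move=> /fintype.subsetP JK; apply: connect_sub => {}x {}y /and3P[/JK xK /JK yK xy].
by apply: connect1; rewrite /edgeJ xK yK.
Qed.

Lemma conn_setU I J i j : conn I -> conn J -> i \in I -> j \in J -> (i == j) || adj i j ->
  conn (I :|: J).
Proof.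
move=> cI cJ iI jJ ij; have iU : i \in I :|: J by rewrite finset.inE iI.
apply: (conn_root iU) => y; rewrite finset.inE => /orP[yI|yJ].
  by apply: connectJ_sub (conn_connect cI iI yI); apply: finset.subsetUl.
apply: (@connect_trans _ _ j).
  case/orP: ij => [/eqP->//|ij]; apply: connect1; rewrite /edgeJ iU ij !finset.inE jJ orbT //.
by apply: connectJ_sub (conn_connect cJ jJ yJ); apply: finset.subsetUr.
Qed.

Lemma conn1 x : conn [set x]%SET.
Proof.
apply: (@conn_root _ x) => [|y]; rewrite finset.inE // => /eqP->.
exact: connect0.
Qed.

(** The relation between incomparable members of a nested set, combining (N2) with (N3) for pairs;
    see [nestedP]. *)
Definition apart I J := [forall i in I, forall j in J, (i != j) && ~~ adj i j].

Lemma apartP I J : reflect (forall i j, i \in I -> j \in J -> i != j /\ ~~ adj i j) (apart I J).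
Proof.
apply: (iffP forallP) => [H i j iI jJ|H i].
  by have /implyP/(_ iI)/forallP/(_ j)/implyP/(_ jJ)/andP := H i.
by apply/implyP => iI; apply/forallP => j; apply/implyP => jJ; apply/andP; apply: H.
Qed.

Lemma apartC I J : apart I J = apart J I.
Proof.
by apply/apartP/apartP => H i j iI jJ; have [] := H j i jJ iI; rewrite adjC eq_sym.
Qed.

Lemma apartS I J I' J' : I' \subset I -> J' \subset J -> apart I J -> apart I' J'.
Proof.
move=> /fintype.subsetP II /fintype.subsetP JJ /apartP H.
by apply/apartP => i j /II iI /JJ jJ; apply: H.
Qed.

Lemma apart_meet I J x : x \in I -> x \in J -> apart I J = false.
Proof. by move=> xI xJ; apply/apartP => /(_ x x xI xJ)[/eqP]. Qed.

Lemma apart_disjoint I J : apart I J -> disjoint (mem I) (mem J).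
Proof.
move=> /apartP H; rewrite disjoint_subset; apply/fintype.subsetP => x xI.
by rewrite inE; apply/negP => xJ; have [/eqP] := H x x xI xJ.
Qed.

Lemma conn_apart_union A B K : conn K -> K \subset A :|: B -> apart A B ->
  K \subset A \/ K \subset B.
Proof.
move=> cK KAB /apartP ap.
have [/eqP e|/finset.set0Pn[x xKA]] := boolP (K :&: A == finset.set0).
  right; apply/fintype.subsetP => x xK; have := fintype.subsetP KAB _ xK.
  rewrite finset.inE => /orP[xA|//]; have : x \in K :&: A by rewrite finset.inE xK.
  by rewrite e finset.inE.
left; have [<-|ne] := eqVneq (K :&: A)%SET K; first exact: finset.subsetIr.
have [|i [j []]] := conn_cut cK (finset.subsetIl K A) _ ne; first by apply/finset.set0Pn; exists x.
rewrite !finset.inE => /andP[iK iA] jK; rewrite jK /= => jA.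
have := fintype.subsetP KAB _ jK; rewrite finset.inE (negPf jA) /= => jB.
by have [_ /negPf ->] := ap i j iA jB.
Qed.

Lemma comp_conn J K : is_comp C J K -> conn K.
Proof. by case/and3P. Qed.

Lemma comp_sub J K : is_comp C J K -> K \subset J.
Proof. by case/and3P. Qed.

Lemma comp_max J K A x : is_comp C J K -> conn A -> A \subset J ->
  x \in A -> x \in K -> A \subset K.
Proof.
case/and3P=> KJ cK /forallP noadj cA AJ xA xK.
have [<-|ne] := eqVneq (A :&: K)%SET A; first exact: finset.subsetIr.
have [|i [j []]] := conn_cut cA (finset.subsetIl A K) _ ne.
  by apply/finset.set0Pn; exists x; rewrite finset.inE xA.
rewrite !finset.inE => /andP[iA iK] jA; rewrite jA /= => jK.
have /implyP/(_ iK)/forallP/(_ j)/implyP := noadj i.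
by rewrite finset.inE jK (fintype.subsetP AJ) // => /(_ isT)/negPf ->.
Qed.

Lemma comp_apart J K K' : is_comp C J K -> is_comp C J K' -> K != K' -> apart K K'.
Proof.
move=> cK cK' ne; apply/apartP => i j iK jK'.
have jK : j \notin K.
  apply: contraNN ne => jK; rewrite finset.eqEsubset.
  rewrite (comp_max cK (comp_conn cK') (comp_sub cK') jK') //.
  by rewrite (comp_max cK' (comp_conn cK) (comp_sub cK) jK).
split; first by apply: contraNneq jK => <-.
have /and3P[_ _ /forallP/(_ i)/implyP/(_ iK)/forallP/(_ j)/implyP] := cK; apply.
by rewrite finset.inE jK (fintype.subsetP (comp_sub cK')).
Qed.

(** A largest connected subset of [J] through [x] is a component, because an adjacent vertex of [J]
    could be adjoined. *)
Lemma comp_ex J x : x \in J -> exists2 K, is_comp C J K & x \in K.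
Proof.
move=> xJ; pose P (K : {set 'I_n}) := [&& conn K, x \in K & K \subset J].
have P0 : P [set x]%SET by rewrite /P conn1 finset.inE eqxx finset.sub1set.
have [K /and3P[cK xK KJ] maxK] := @arg_maxnP _ [set x]%SET P (fun K : {set 'I_n} => #|K|) P0.
exists K => //; apply/and3P; split=> //; apply/forallP => i; apply/implyP => iK.
apply/forallP => j; rewrite finset.inE; apply/implyP => /andP[jK jJ]; apply/negP => ij.
have : P (K :|: [set j])%SET.
  rewrite /P (conn_setU cK (conn1 j) iK (finset.set11 j)) ?ij ?orbT // finset.inE xK /=.
  by rewrite finset.subUset KJ finset.sub1set.
by move/maxK; rewrite /= finset.setUC finset.cardsU1 jK add1n ltnn.
Qed.

Lemma comp_ex_sub J A : conn A -> A \subset J -> exists2 K, is_comp C J K & A \subset K.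
Proof.
move=> cA AJ; have /finset.set0Pn[x xA] := conn_neq0 cA.
have [K cK xK] := comp_ex (fintype.subsetP AJ _ xA).
by exists K => //; apply: (comp_max cK cA AJ xA).
Qed.

Definition comps J : {set {set 'I_n}} := [set K | is_comp C J K]%SET.

(** An adjacency between two disjoint members would connect their union, against (N3). Conversely, a
    connected union of disjoint members has an edge leaving one of them into another, which [apart]
    excludes. *)
Lemma nestedP N : nested C N <-> (forall J, J \in N -> conn J) /\
  (forall I J, I \in N -> J \in N -> [|| I \subset J, J \subset I | apart I J]).
Proof.
split=> [[N1 [N2 N3]]|[N1 N2]]; split=> //.
  move=> I J IN JN; have := N2 I J IN JN.
  case IJ : (I \subset J) => //=; case JI : (J \subset I) => //= dIJ.
  apply/apartP => i j iI jJ; have ij : i != j.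
    apply: contraTneq dIJ => e; apply/negP => /disjointFr/(_ iI).
    by rewrite e jJ.
  split=> //; apply/negP => aij.
  have neIJ : I != J by apply: contraFneq IJ => ->.
  have /negP[] : ~~ conn (\bigcup_(J0 in [set I; J]) J0)%SET.
    apply: N3.
    - by apply/fintype.subsetP => K; rewrite !finset.inE => /orP[]/eqP->.
    - by rewrite finset.cards2 neIJ.
    - move=> I' J'; rewrite !finset.inE => /orP[]/eqP-> /orP[]/eqP->; rewrite ?eqxx // => _.
      by rewrite disjoint_sym.
  rewrite big_setU1 ?finset.in_set1 // big_set1.
  by apply: conn_setU iI jJ _; rewrite ?N1 // aij orbT.
split=> [I J IN JN|S SN S2 disS].
  have /or3P[->//|->|/apart_disjoint ->] := N2 I J IN JN; by rewrite ?orbT.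
have /fintype.card_gt0P[I IS] : (0 < #|S|)%N by apply: leq_trans S2.
have [J JS IJ] : exists2 J, J \in S & J != I.
  apply: contrapT => H; move: S2; suff -> : S = [set I]%SET by rewrite finset.cards1.
  apply/finset.setP => J; rewrite finset.inE; apply/idP/eqP => [JS|-> //].
  by apply/eqP; apply: contrapT => /negP ne; apply: H; exists J.
have SNP := fintype.subsetP SN.
apply/negP => cU; have IU : I \subset (\bigcup_(J0 in S) J0)%SET by apply: finset.bigcup_sup.
have /finset.set0Pn[y yJ] := conn_neq0 (N1 J (SNP _ JS)).
have yI : y \notin I by rewrite (disjointFr (disS J I JS IS IJ) yJ).
have [||i [j [iI /finset.bigcupP[K KS jK] jI ij]]] := conn_cut cU IU.
- exact: conn_neq0 (N1 I (SNP _ IS)).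
- apply: contraNneq yI => ->; apply/finset.bigcupP; by exists J.
have IK : I != K by apply: contraNneq jI => ->.
have := disS I K IS KS IK; have /or3P[sIK|sKI|ap] := N2 I K (SNP _ IS) (SNP _ KS).
- by move=> /disjointFr/(_ iI); rewrite (fintype.subsetP sIK).
- by case/negP: jI; apply: (fintype.subsetP sKI).
by have /apartP/(_ i j iI jK)[_ /negPf] := ap; rewrite ij.
Qed.

End Graph.

(** * Nested sets *)

Section NestedSets.
Variables (n : nat) (C : 'M[int]_n).

Implicit Types (i j k x y : 'I_n) (A B I J K : {set 'I_n}) (N M S : {set {set 'I_n}}).

Notation conn := (connectedJ C).
Notation nested := (nested C).
Notation comps := (comps C).

Lemma nested_conn N J : nested N -> J \in N -> conn J.
Proof. by move=> /nestedP[H _]; apply: H. Qed.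

Lemma nested_pair N I J : nested N -> I \in N -> J \in N ->
  [|| I \subset J, J \subset I | apart C I J].
Proof. by move=> /nestedP[_ H]; apply: H. Qed.

Lemma nested_sub N M : M \subset N -> nested N -> nested M.
Proof.
move=> /fintype.subsetP MN /nestedP[N1 N2]; apply/nestedP; split=> [J /MN /N1 //|I J /MN IN /MN].
exact: N2.
Qed.

(** Take the largest member of [S] through a vertex of [K]. An edge of [K] leaving it would lead
    into a member comparable with it, against maximality or the choice of the edge. *)
Lemma nested_cover N S K : nested N -> S \subset N -> conn K ->
  K \subset (\bigcup_(J in S) J)%SET -> exists2 J, J \in S & K \subset J.
Proof.
move=> nN /fintype.subsetP SN cK KS; have /finset.set0Pn[x xK] := conn_neq0 cK.
have /finset.bigcupP[J0 J0S xJ0] := fintype.subsetP KS _ xK.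
have P0 : (J0 \in S) && (x \in J0) by rewrite J0S.
have [J /andP[JS xJ] maxJ] := @arg_maxnP _ J0 (fun J => (J \in S) && (x \in J))
  (fun K : {set 'I_n} => #|K|) P0.
exists J => //; have [<-|ne] := eqVneq (K :&: J)%SET K; first exact: finset.subsetIr.
have [|i [j []]] := conn_cut cK (finset.subsetIl K J) _ ne.
  by apply/finset.set0Pn; exists x; rewrite finset.inE xK.
rewrite !finset.inE => /andP[iK iJ] jK; rewrite jK /= => jJ ij.
have /finset.bigcupP[J' J'S jJ'] := fintype.subsetP KS _ jK.
have /or3P[s|s|/apartP/(_ i j iJ jJ')[_ /negP]] := nested_pair nN (SN _ JS) (SN _ J'S) => //.
  have := maxJ J'; rewrite J'S (fintype.subsetP s) // => /(_ isT) /= le.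
  have /eqP e : J == J' by rewrite finset.eqEcard s.
  by rewrite e jJ' in jJ.
by rewrite (fintype.subsetP s) in jJ.
Qed.

(** * Parities of nested sets *)

Definition above N K : {set {set 'I_n}} := [set J in N | K \subset J]%SET.
(** The parity that decides whether a positive root of support [K] is an inversion of the product;
    it is additive under symmetric difference. *)
Definition par N K : bool := odd #|above N K|.
Definition symd (T : finType) (X Y : {set T}) : {set T} := ((X :\: Y) :|: (Y :\: X))%SET.

Lemma in_symd (T : finType) (X Y : {set T}) z : (z \in symd X Y) = (z \in X) (+) (z \in Y).
Proof. by rewrite !finset.inE; case: (z \in X); case: (z \in Y). Qed.

Lemma odd_symd (T : finType) (X Y : {set T}) : odd #|symd X Y| = odd #|X| (+) odd #|Y|.
Proof.
have d : disjoint (mem (X :\: Y)%SET) (mem (Y :\: X)%SET).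
  rewrite disjoint_subset; apply/fintype.subsetP => z; rewrite !inE.
  by case: (z \in X); case: (z \in Y).
have e : #|symd X Y| = (#|(X :\: Y)%SET| + #|(Y :\: X)%SET|)%N.
  by have := leq_card_setU (X :\: Y)%SET (Y :\: X)%SET => -[_]; rewrite d => /eqP.
have eX := finset.cardsID Y X; have eY := finset.cardsID X Y.
by rewrite e -eX -eY finset.setIC !oddD; case: (odd _); case: (odd _); case: (odd _).
Qed.

Lemma par_symd N M K : par (symd N M) K = par N K (+) par M K.
Proof.
rewrite /par -odd_symd; congr (odd #|pred_of_set _|); apply/finset.setP => J.
by rewrite [in RHS]in_symd !finset.inE; case: (_ \subset _); case: (J \in N); case: (J \in M).
Qed.

(** Distinct components are apart, so at most one contains the nonempty [K]. Toggling the components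
    of [J] thus flips the parity of exactly the connected subsets of [J]. *)
Lemma par_comps J K : conn K -> par (comps J) K = (K \subset J).
Proof.
move=> cK; have /finset.set0Pn[x xK] := conn_neq0 cK; rewrite /par.
have [KJ|KJ] := boolP (K \subset J).
  have [A cA KA] := comp_ex_sub cK KJ.
  rewrite (_ : above _ _ = [set A])%SET ?finset.cards1 //; apply/finset.setP => B.
  rewrite !finset.inE; apply/andP/eqP => [[cB KB]|->//].
  apply/eqP; apply: contraT => /(comp_apart cB cA).
  by rewrite (@apart_meet _ _ _ _ x) // ?(fintype.subsetP KB) ?(fintype.subsetP KA).
rewrite (_ : above _ _ = finset.set0) ?finset.cards0 //; apply/finset.setP => B.
rewrite !finset.inE; apply/negP => /andP[cB KB]; case/negP: KJ.
exact: fintype.subset_trans KB (comp_sub cB).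
Qed.

Lemma nested_comps J N : nested N -> (forall I, I \in N -> I \subset J) ->
  nested (N :|: comps J).
Proof.
move=> nN NJ.
have key I K : I \in N -> is_comp C J K -> (I \subset K) || apart C I K.
  move=> IN cK; have cI := nested_conn nN IN.
  have [K' cK' IK'] := comp_ex_sub cI (NJ _ IN).
  have [<-|ne] := eqVneq K' K; first by rewrite IK'.
  by rewrite (apartS IK' (subxx _) (comp_apart cK' cK ne)) orbT.
apply/nestedP; split=> [K|I K].
  by rewrite !finset.inE => /orP[|/comp_conn //]; apply: (nested_conn nN).
rewrite !finset.inE => /orP[IN|cI] /orP[KN|cK].
- exact: (nested_pair nN).
- by have /orP[->//|->] := key _ _ IN cK; rewrite !orbT.
- by have /orP[->|] := key _ _ KN cI; rewrite ?orbT // apartC => ->; rewrite !orbT.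
- by have [->|/(comp_apart cI cK) ->] := eqVneq I K; rewrite ?subxx ?orbT.
Qed.

Lemma nested_symd_comps J N : nested N -> (forall I, I \in N -> I \subset J) ->
  nested (symd N (comps J)) /\ forall I, I \in symd N (comps J) -> I \subset J.
Proof.
move=> nN NJ; split.
  apply: nested_sub (nested_comps nN NJ); apply/fintype.subsetP => I.
  by rewrite in_symd finset.in_setU; case: (I \in N) => //= ->.
move=> I; rewrite in_symd; case IN : (I \in N) => /=; first by move=> _; apply: NJ.
by rewrite finset.inE; apply: comp_sub.
Qed.

Lemma nested_setU1 J N : conn J -> nested N -> (forall I, I \in N -> I \subset J) ->
  nested (J |: N)%SET.
Proof.
move=> cJ nN NJ; apply/nestedP; split=> [K|I K].
  by rewrite finset.in_setU1 => /orP[/eqP->//|]; apply: (nested_conn nN).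
rewrite !finset.in_setU1 => /orP[/eqP->|IN] /orP[/eqP->|KN]; rewrite ?subxx ?NJ ?orbT //.
exact: (nested_pair nN).
Qed.

(* A maximal element of the symmetric difference would separate the parities. *)
Lemma par_inj N M : (forall J, J \in N -> conn J) -> (forall J, J \in M -> conn J) ->
  (forall K, conn K -> par N K = par M K) -> N = M.
Proof.
move=> cN cM e; apply/eqP; apply: contraT => ne.
have [J0 J0D] : exists J, J \in symd N M.
  apply: contrapT => H; case/negP: ne; apply/eqP/finset.setP => J.
  have : ~~ (J \in symd N M) by apply/negP => JD; apply: H; exists J.
  by rewrite in_symd; case: (J \in N); case: (J \in M).
have [J JD maxJ] := @arg_maxnP _ J0 (mem (symd N M)) (fun K : {set 'I_n} => #|K|) J0D.
have cJ : conn J.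
  by move: JD; rewrite /= in_symd; case JN : (J \in N) => /= JM; [apply: cN | apply: cM].
have := par_symd N M J; rewrite e // addbb /par.
rewrite (_ : above _ _ = [set J])%SET ?finset.cards1 //; apply/finset.setP => K.
rewrite [in LHS]finset.inE finset.in_set1; apply/andP/eqP => [[KD JK]|-> //].
by apply/esym/eqP; rewrite finset.eqEcard JK; apply: maxJ.
Qed.

(* Adding a full support [J] and toggling the components of [J] minus [i]
   complements all inversions with support in [J]. *)
Lemma par_full J N i K : i \in J -> (forall I, I \in N -> I \subset (J :\ i)%SET) ->
  conn K -> K \subset J ->
  par (J |: symd N (comps (J :\ i)))%SET K = (i \in K) || par N K.
Proof.
move=> iJ NJ cK KJ.
have SJ I : I \in symd N (comps (J :\ i)) -> I \subset (J :\ i)%SET.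
  rewrite in_symd; case IN : (I \in N) => /=; first by move=> _; apply: NJ.
  by rewrite finset.inE; apply: comp_sub.
have JS : J \notin symd N (comps (J :\ i)).
  apply/negP => /SJ /fintype.subsetP/(_ i iJ); by rewrite !finset.inE eqxx.
have -> : (J |: symd N (comps (J :\ i)))%SET = symd [set J]%SET (symd N (comps (J :\ i))).
  apply/finset.setP => I; rewrite finset.in_setU1 [in RHS]in_symd finset.in_set1.
  by have [->|//] := eqVneq I J; rewrite (negPf JS).
rewrite !par_symd par_comps //.
have -> : par [set J]%SET K.
  rewrite /par (_ : above _ _ = [set J]%SET) ?finset.cards1 //; apply/finset.setP => I.
  by rewrite !finset.inE; have [->|//] := eqVneq I J; rewrite KJ.
have [iK|iK] := boolP (i \in K).
  have nK I : I \subset (J :\ i)%SET -> (K \subset I) = false.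
    move=> IJ; apply/negP => KI.
    by have := fintype.subsetP (fintype.subset_trans KI IJ) _ iK; rewrite !finset.inE eqxx.
  rewrite nK // addbF /par (_ : above _ _ = finset.set0) ?finset.cards0 //.
  apply/finset.setP => I; rewrite !finset.inE; apply/negP => /andP[/NJ IJ].
  by rewrite nK.
have -> : K \subset (J :\ i)%SET by rewrite finset.subsetD1 KJ iK.
by case: (par N K).
Qed.

(** Glues nested sets living on the components, for the reducible case of separability: members on
    different components are apart, so only those of the component around [A] can contain [A]. *)
Lemma nested_bigcup J (f : {set 'I_n} -> {set {set 'I_n}}) :
  (forall K, is_comp C J K -> nested (f K) /\ forall I, I \in f K -> I \subset K) ->
  nested (\bigcup_(K in comps J) f K)%SET /\
  (forall I, I \in (\bigcup_(K in comps J) f K)%SET -> I \subset J) /\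
  forall K A, is_comp C J K -> conn A -> A \subset K ->
    par (\bigcup_(K in comps J) f K)%SET A = par (f K) A.
Proof.
move=> Hf; have inU I : I \in (\bigcup_(K in comps J) f K)%SET ->
    exists K, [/\ is_comp C J K, I \in f K & I \subset K].
  move=> /finset.bigcupP[K]; rewrite finset.inE => cK IK; exists K; split=> //.
  by have [_ ->] := Hf K cK.
split; [|split].
- apply/nestedP; split=> [I /inU[K [cK IK _]]|I I' /inU[K [cK IK sK]] /inU[K' [cK' IK' sK']]].
    by apply: nested_conn IK; case: (Hf K cK).
  have [e|ne] := eqVneq K K'; last by rewrite (apartS sK sK' (comp_apart cK cK' ne)) !orbT.
  by subst K'; apply: nested_pair IK IK'; case: (Hf K cK).
- by move=> I /inU[K [cK _ sK]]; apply: fintype.subset_trans sK (comp_sub cK).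
move=> K A cK cA AK; rewrite /par; congr (odd #|pred_of_set _|).
apply/finset.setP => I; rewrite !finset.inE.
apply/andP/andP => [[/inU[K' [cK' IK' sK']] AI]|[IK AI]]; split=> //.
  suff <- : K' = K by [].
  apply/eqP; apply: contraT => /(comp_apart cK' cK).
  have /finset.set0Pn[x xA] := conn_neq0 cA.
  have xK' : x \in K' by apply/(fintype.subsetP sK')/(fintype.subsetP AI).
  by rewrite (apart_meet C xK' (fintype.subsetP AK _ xA)).
by apply/finset.bigcupP; exists K; rewrite ?finset.inE.
Qed.

End NestedSets.

(** * Inversions of the product of longest elements *)

Section Inversions.
Variables (n : nat) (C : 'M[int]_n).
Hypotheses (cartanC : is_cartan C) (finW : finite_set (W C)).

Implicit Types (i j k : 'I_n) (w v u : 'M[int]_n) (s t : seq {set 'I_n}).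
Implicit Types (b x y : 'cV[int]_n) (A I J K : {set 'I_n}) (N M S : {set {set 'I_n}}).

Notation pos := (pos_roots C).
Notation negr := (negr C).
Notation conn := (connectedJ C).
Notation inv := (inv C).
Notation comps := (comps C).
Notation wprod := (wprod C).

Lemma supp_sroot i : supp (sroot i) = [set i]%SET.
Proof.
apply/finset.setP => j; rewrite !finset.inE !mxE eqxx andbT.
by case: (j == i).
Qed.

(** [root_cut] supplies an edge across every cut of the support. *)
Lemma supp_conn b : roots C b -> conn (supp b).
Proof.
move=> rb; apply: cut_conn.
  apply/negP => /eqP b0; apply: (root_neq0 cartanC rb); apply/matrixP => i j.
  have : i \notin supp b by rewrite b0 finset.inE.
  by rewrite finset.inE negbK ord1 mxE => /eqP.
move=> A AS A0 AnS; have [i [j [iA jS jA Cij]]] := root_cut cartanC finW rb AS A0 AnS.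
exists i, j; split=> //; rewrite adjE // Cij andbT.
by apply: contraNneq jA => <-.
Qed.

(** Among the subsets of [K] that are supports of positive roots take a largest one. If it misses an
    adjacent vertex [j] of [K], reflecting the root in [sroot j] adds [j] to the support. *)
Lemma conn_supp K : conn K -> exists b, pos b /\ supp b = K.
Proof.
move=> cK; have /finset.set0Pn[x xK] := conn_neq0 cK.
pose P A := (A \subset K) && `[< exists b, pos b /\ supp b = A >].
have P0 : P [set x]%SET.
  rewrite /P finset.sub1set xK; apply/asboolP; exists (sroot x); rewrite supp_sroot.
  by split=> //; apply: pos_sroot.
have [A /andP[AK /asboolP[b [pb sb]]] maxA] :=
  @arg_maxnP _ _ P (fun K : {set 'I_n} => #|K|) P0.
have [e|ne] := eqVneq A K; first by exists b; rewrite -e.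
have A0 : A != finset.set0 by rewrite -sb; apply: conn_neq0 (supp_conn pb.1).
have [i [j [iA jK jA ij]]] := conn_cut cK AK A0 ne.
have [C2 [C0 _]] := cartanC.
have bj : b j 0 = 0 by apply/eqP; move: jA; rewrite -sb finset.inE negbK.
have bi : 0 < b i 0 by rewrite lt0r pb.2 andbT; move: iA; rewrite -sb finset.inE.
(* As [b j 0 = 0], the new coordinate is minus a sum of nonpositive terms, and the term of the
   neighbour [i] is strictly negative. *)
have sj : 0 < (sref C j *m b) j 0.
  rewrite sref_mulE !mxE !eqxx bj mulr1 sub0r oppr_gt0 /coroot (bigD1 i) //=.
  rewrite ltr_wnDr //.
    apply: sumr_le0 => k ki; have [<-|jk] := eqVneq j k; first by rewrite bj mulr0.
    by apply: mulr_le0_ge0; rewrite ?pb.2 // C0.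
  move: ij; rewrite adjC adjE // => /andP[ji Cji].
  by rewrite pmulr_llt0 // lt_def eq_sym Cji C0.
suff : P (j |: A)%SET by move/maxA; rewrite /= finset.cardsU1 jA add1n ltnn.
rewrite /P finset.subUset finset.sub1set jK AK /=; apply/asboolP.
exists (sref C j *m b); split.
  by apply: (pos_coord cartanC finW _ sj); apply: roots_W pb.1; apply: W_sref.
apply/finset.setP => k; rewrite finset.in_setU1 -sb !finset.inE.
have [->|kj] := eqVneq k j; first by rewrite gt_eqF.
by rewrite sref_coord.
Qed.

Lemma negr_w0 J x : roots C x -> negr (w0 C J *m x) = (supp x \subset J) (+) negr x.
Proof.
move=> rx; have Jw := w0_WJ cartanC finW J.
have key b : pos b -> negr (w0 C J *m b) = (supp b \subset J).
  move=> pb; apply/idP/idP => [/asboolP H|/supp_span bJ].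
    apply: contrapT => nS; apply: (pos_notN cartanC _ H).
    by apply: (WJ_pos cartanC finW Jw pb) => /supp_span.
  by apply/asboolP; apply: w0_neg.
have [px|px] := root_sign cartanC finW rx; first by rewrite key // (negr_pos cartanC px) addbF.
have sN : supp (- x) = supp x by apply/finset.setP => i; rewrite !finset.inE mxE oppr_eq0.
have nx : negr x by apply/asboolP.
have rwx : roots C (w0 C J *m x) by apply: roots_W rx; apply: WJW Jw.
by have := key _ px; rewrite mulmxN (negrN cartanC finW) // sN nx addbT => <-; rewrite negbK.
Qed.

(** [WJ C I] preserves the span of a [J] containing [I] and fixes the span of an apart [J]
    pointwise; the converse direction uses the inverse of [w]. *)
Lemma WJ_span_iff I J w x : WJ C I w -> (I \subset J) || apart C I J ->
  spanJ J (w *m x) <-> spanJ J x.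
Proof.
move=> Iw IJ.
have key v y : WJ C I v -> spanJ J y -> spanJ J (v *m y).
  move=> Iv yJ; case/orP: IJ => [IJ|/apartP ap]; first exact: WJ_span (WJ_sub IJ Iv) yJ.
  rewrite (WJ_fix Iv) // => i j iI yj.
  have [|ij] := ap i j iI; first by apply: contraNT yj => /yJ ->.
  by rewrite adjE // ij /= negbK => /eqP.
split; last exact: key.
by move/(key _ _ (WJV cartanC Iw)); rewrite mulKmx // (WJ_unit cartanC Iw).
Qed.

Lemma wprod_W s : W C (wprod s).
Proof.
elim: s => [|J s IH] /=; first exact: WJ1.
by apply: WJM => //; apply: WJW (w0_WJ cartanC finW J).
Qed.

Lemma wprod_span s J x : (forall I, I \in s -> (I \subset J) || apart C I J) ->
  spanJ J (wprod s *m x) <-> spanJ J x.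
Proof.
elim: s => [|I s IH] H /=; first by rewrite mul1mx.
rewrite -mulmxA (WJ_span_iff _ (w0_WJ cartanC finW I)) ?H ?mem_head //.
by apply: IH => K Ks; apply: H; rewrite inE Ks orbT.
Qed.

(** No later member properly contains the head [J], so each is inside [J] or apart from it, and the
    product of the tail preserves membership in the span of [J]. The factor [w0 C J] then flips the
    sign exactly when [supp b] lies in [J]. *)
Lemma negr_wprod s b : uniq s -> pairwise (fun I J => ~~ (I \proper J)) s ->
  {in s &, forall I J, [|| I \subset J, J \subset I | apart C I J]} -> roots C b ->
  negr (wprod s *m b) = odd (count (fun J : {set 'I_n} => supp b \subset J) s) (+) negr b.
Proof.
move=> + + + rb; elim: s => [|J s IH] /=; first by rewrite mul1mx.
move=> /andP[Js us] /andP[/allP Jmax ps] nest.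
have rvb : roots C (wprod s *m b) by apply: roots_W rb; apply: wprod_W.
rewrite -mulmxA negr_w0 // IH //; last first.
  by move=> I K Is Ks; apply: nest; rewrite inE ?Is ?Ks orbT.
rewrite oddD addbA; congr (_ (+) _ (+) _); rewrite oddb.
have sub I : I \in s -> (I \subset J) || apart C I J.
  move=> Is; have /or3P[->//|JI|->] := nest I J (mem_behead (s := J :: s) Is) (mem_head _ _);
    last by rewrite orbT.
  have := Jmax I Is; rewrite finset.properEneq JI andbT negbK => /eqP e.
  by rewrite e Is in Js.
by apply/idP/idP => /supp_span/(wprod_span _ sub)/supp_span.
Qed.

Definition invN N : set 'cV[int]_n := [set b | pos b /\ par N (supp b)].

(** The right-hand side does not mention [s]: with [inv_inj] this gives independence of the
    monotonic order. *)
Lemma inv_wprod N s : nested C N -> monotonic N s -> inv (wprod s) = invN N.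
Proof.
move=> nN [us [mem mono]].
have e b : roots C b -> negr (wprod s *m b) = par N (supp b) (+) negr b.
  move=> rb; rewrite negr_wprod //.
  - congr (odd _ (+) _); rewrite -size_filter -(card_uniqP (filter_uniq _ us)).
    by apply: eq_card => J; rewrite mem_filter !finset.inE mem andbC.
  - apply/(pairwiseP finset.set0) => i j; rewrite !inE => ilt jlt ij; apply/negP.
    move=> /andP[sIJ nJI].
    have ne : nth finset.set0 s j != nth finset.set0 s i by apply: contraNneq nJI => ->.
    have jN : nth finset.set0 s j \in N by rewrite -mem mem_nth.
    have iN : nth finset.set0 s i \in N by rewrite -mem mem_nth.
    by have := mono _ _ jN iN sIJ ne; rewrite !index_uniq // ltnNge ltnW.
  - by move=> I J; rewrite !mem => IN JN; apply: (nested_pair nN).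
apply/seteqP; split=> b.
  by move=> /invE[pb]; rewrite e ?(negr_pos cartanC pb) ?addbF //; case: (pb).
by move=> [pb H]; apply/invE; split=> //; rewrite e ?(negr_pos cartanC pb) ?addbF //; case: (pb).
Qed.

End Inversions.

(** * Separable elements *)

Section Separable.
Variables (n : nat) (C : 'M[int]_n).
Hypotheses (cartanC : is_cartan C) (finW : finite_set (W C)).

Implicit Types (i j k : 'I_n) (w v u : 'M[int]_n) (s t : seq {set 'I_n}).
Implicit Types (b x y : 'cV[int]_n) (A I J K : {set 'I_n}) (N M S : {set {set 'I_n}}).

Notation pos := (pos_roots C).
Notation conn := (connectedJ C).
Notation inv := (inv C).
Notation comps := (comps C).
Notation wprod := (wprod C).
Notation nested := (nested C).
Notation invN := (invN C).

Lemma monotonic_exists N : exists s, monotonic N s.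
Proof.
(* Larger sets first: a proper subset has smaller cardinality and therefore comes later. *)
pose r : rel {set 'I_n} := fun I J => (#|J| <= #|I|)%N.
exists (sort r (enum N)); split; first by rewrite sort_uniq enum_uniq.
split=> [J|I J IN JN JI ne]; first by rewrite mem_sort mem_enum.
have rt : transitive r by move=> I1 I2 I3; rewrite /r => a b; apply: leq_trans b a.
have tot : total r by move=> I1 I2; rewrite /r leq_total.
rewrite ltnNge; apply/negP => le.
have := sorted_leq_index rt (fun I => leqnn _) (sort_sorted tot (enum N)).
move=> /(_ J I); rewrite !mem_sort !mem_enum => /(_ JN IN le); rewrite /r => c.
by case/negP: ne; rewrite eq_sym finset.eqEcard JI.
Qed.

Lemma par_sub J N K : (forall I, I \in N -> I \subset J) -> par N K -> K \subset J.
Proof.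
move=> NJ; rewrite /par; have [->|/finset.set0Pn[I]] := eqVneq (above N K) finset.set0.
  by rewrite finset.cards0.
by rewrite finset.inE => /andP[/NJ IJ KI] _; apply: fintype.subset_trans KI IJ.
Qed.

Lemma restr_spec A w : W C w -> WJ C A (restr C A w) /\
  inv (restr C A w) `&` spanJ A = inv w `&` spanJ A.
Proof.
move=> Ww; rewrite /restr.
apply: (@xgetPex _ _ [set v | WJ C A v /\ inv v `&` spanJ A = inv w `&` spanJ A]).
exact: restr_exists.
Qed.

Lemma inv_restr A w b : W C w -> inv (restr C A w) b <-> inv w b /\ supp b \subset A.
Proof.
move=> Ww; have [Ar e] := restr_spec A Ww; split=> [nb|[nb /supp_span bA]].
  have bA := WJ_inv_span Ar nb; split; last exact/supp_span.
  by have : (inv w `&` spanJ A) b by [rewrite -e]; case.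
by have : (inv (restr C A w) `&` spanJ A) b by [rewrite e]; case.
Qed.

(** A restriction retains only roots with support in [A], so only the parities of connected subsets
    of [A] matter. *)
Lemma restr_invN A N M w : W C w -> inv w = invN N ->
  (forall I, I \in M -> I \subset A) ->
  (forall K, conn K -> K \subset A -> par M K = par N K) ->
  inv (restr C A w) = invN M.
Proof.
move=> Ww e MA H; apply/seteqP; split=> b.
  move=> /(inv_restr _ _ Ww); rewrite e => -[[pb Nb] bA]; split=> //.
  by rewrite H // (supp_conn cartanC finW pb.1).
move=> [pb Mb]; apply/inv_restr => //; have bA := par_sub MA Mb; split=> //.
by rewrite e; split=> //; rewrite -H // (supp_conn cartanC finW pb.1).
Qed.

Lemma par_above1 J N K : (forall I, I \in N -> K \subset I -> I = J) ->
  K \subset J -> par N K = (J \in N).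
Proof.
move=> H KJ; have [JN|JN] := boolP (J \in N); rewrite /par.
  rewrite (_ : above N K = [set J]%SET) ?finset.cards1 //; apply/finset.setP => I.
  rewrite !finset.inE; apply/andP/eqP => [[IN KI]|->]; [exact: H | by []].
rewrite (_ : above N K = finset.set0) ?finset.cards0 //; apply/finset.setP => I.
rewrite !finset.inE; apply/negP => /andP[IN KI]; case/negP: JN.
by rewrite -(H I IN KI).
Qed.

(** Induction on the fuel along the definition of separability. A disconnected [J] passes to each
    component the members inside it. A connected [J] loses a vertex [i] lying in no member other
    than [J]; the roots involving [i] are all inverted or all not, according to whether [J] is in
    [N]. *)
Lemma nested_sep m J w N : (#|J| < m)%N -> W C w -> nested N ->
  (forall I, I \in N -> I \subset J) -> inv w = invN N -> sep_aux C m J w.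
Proof.
(* A single vertex is handled as a connected set: removing it leaves the empty set, which has no
   components and consumes one more unit of fuel, hence the strict bound [#|J| < m]. *)
elim: m J w N => // m IH J w N Jm Ww nN NJ e /=; right.
have [cJ|cJ] := boolP (conn J); [right|left]; split=> //; last first.
  move=> K cK; have KJ := comp_sub cK.
  have ltK : (#|K| < m)%N.
    suff : (#|K| < #|J|)%N by move: Jm; lia.
    apply: proper_card; rewrite finset.properEneq KJ andbT.
    by apply: contraNneq cJ => <-; apply: comp_conn cK.
  pose M := [set I in N | I \subset K]%SET.
  have MN : M \subset N by apply/fintype.subsetP => I; rewrite finset.inE => /andP[].
  have MK I : I \in M -> I \subset K by rewrite finset.inE => /andP[].
  apply: (IH K _ M) => //.
  - exact: (WJW (restr_spec K Ww).1).
  - exact: nested_sub nN.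
  apply: restr_invN e MK _ => // A cA AK; congr (odd #|pred_of_set _|).
  apply/finset.setP => I; rewrite !finset.inE; case IN : (I \in N) => //=.
  have [AI|] := boolP (A \subset I); rewrite ?andbF // andbT.
  have /finset.set0Pn[x xA] := conn_neq0 cA.
  exact: comp_max cK (nested_conn nN IN) (NJ _ IN) (fintype.subsetP AI _ xA)
    (fintype.subsetP AK _ xA).
(* If the members other than [J] covered the connected [J], one of them would contain it by
   [nested_cover]. *)
have [i iJ Hi] : exists2 i, i \in J & forall I, I \in N -> I != J -> i \notin I.
  have : ~~ (J \subset (\bigcup_(I in N :\ J) I)%SET).
    apply/negP => /(nested_cover nN (finset.subsetDl _ _) cJ) [I].
    rewrite !finset.inE => /andP[ne IN] JI; case/negP: ne.
    by rewrite finset.eqEsubset NJ.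
  move=> /fintype.subsetPn[i iJ iU]; exists i => // I IN ne; apply: contraNN iU => iI.
  by apply/finset.bigcupP; exists I => //; rewrite !finset.inE ne.
have NJi I : I \in (N :\ J)%SET -> I \subset (J :\ i)%SET.
  rewrite !finset.inE => /andP[ne IN]; rewrite finset.subsetD1 NJ //=.
  exact: Hi.
have nD : nested (N :\ J)%SET by apply: nested_sub (finset.subsetDl _ _) nN.
exists i; split=> //; split.
  have ltJ : (#|(J :\ i)%SET| < m)%N by move: Jm; rewrite (finset.cardsD1 i J) iJ; lia.
  have Wr := WJW (restr_spec (J :\ i)%SET Ww).1.
  have [JN|JN] := boolP (J \in N); last first.
    have ND : (N :\ J)%SET = N.
      by apply/finset.setP => I; rewrite !finset.inE; case: eqP => // ->; rewrite (negPf JN).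
    apply: (IH _ _ N) => //; first by rewrite -ND.
    by apply: restr_invN e _ _ => //; rewrite -ND.
  (* Removing [J] flips the parity of every connected subset of [J :\ i], and toggling the
     components of [J :\ i] flips it back. *)
  have [nS SJ] := nested_symd_comps nD NJi.
  apply: (IH _ _ (symd (N :\ J) (comps (J :\ i)))%SET) => //.
  apply: restr_invN e SJ _ => // K cK KJi.
  rewrite par_symd par_comps // KJi.
  have -> : par N K = par (J |: N :\ J)%SET K by rewrite finset.setD1K.
  have -> : (J |: N :\ J)%SET = symd [set J]%SET (N :\ J)%SET.
    by apply/finset.setP => I; rewrite in_symd !finset.inE; case: eqP.
  have KJ := fintype.subset_trans KJi (finset.subsetDl _ _).
  have J1 : par [set J]%SET K.
    by rewrite (@par_above1 J) ?finset.set11 // => I; rewrite finset.in_set1 => /eqP.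
  by rewrite par_symd J1 addbC.
(* The support of such a root contains [i], so [J] is the only member that can contain it. *)
have key b : pos b -> spanJ J b -> b i 0 != 0 -> par N (supp b) = (J \in N).
  move=> pb /supp_span bJ bi; apply: par_above1 => // I IN bI; apply/eqP.
  apply: contraT => /(Hi I IN)/negP; case; apply: (fintype.subsetP bI).
  by rewrite finset.inE.
have Ui b : rootle (sroot i) b -> b i 0 != 0.
  by move=> /(_ i); rewrite !mxE !eqxx => bi; apply: lt0r_neq0; apply: lt_le_trans bi.
have [JN|JN] := boolP (J \in N); [left|right].
  by move=> b [pb [bJ /Ui bi]]; rewrite e; split=> //; rewrite key.
apply/seteqP; split=> // b [[pb [bJ /Ui bi]]].
by rewrite e => -[_]; rewrite key // (negPf JN).
Qed.

(** The nested set is rebuilt along the definition of separability: [J] alone or nothing for a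
    single vertex, a union over the components for a disconnected [J], and for a connected [J] the
    nested set of [J] minus [i], modified as in [par_full] when the roots involving [i] are
    inverted. *)
Lemma sep_nested m J w : WJ C J w -> sep_aux C m J w ->
  exists N, [/\ nested N, forall I, I \in N -> I \subset J & inv w = invN N].
Proof.
elim: m J w => // m IH J w Jw /= H; have Ww := WJW Jw.
case: H => [/eqP/finset.cards1P[j eJ]|[[cJ H]|[cJ [i [iJ [H U]]]]]].
- subst J; have posj b : pos b -> supp b \subset [set j]%SET -> b = sroot j.
    move=> pb /supp_span bj; apply: (pos_line cartanC pb) => k kj; apply: bj.
    by rewrite finset.inE.
  have n1 (N : {set {set 'I_n}}) : N \subset [set [set j]]%SET -> nested N.
    move=> /fintype.subsetP NJ; apply/nestedP; split=> [I|I K].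
      by move=> /NJ; rewrite finset.inE => /eqP ->; apply: conn1.
    by move=> /NJ; rewrite finset.inE => /eqP -> /NJ; rewrite finset.inE => /eqP ->; rewrite subxx.
  have [wj|wj] := pselect (inv w (sroot j)).
    exists [set [set j]]%SET; split; first exact: n1.
      by move=> I; rewrite finset.inE => /eqP->.
    apply/seteqP; split=> b.
      move=> nb; have /supp_span bj := WJ_inv_span Jw nb; split; first by case: nb.
      rewrite (@par_above1 [set j]%SET) ?finset.set11 // => I.
      by rewrite finset.in_set1 => /eqP.
    move=> [pb /par_sub bj]; rewrite (posj b) // bj // => I.
    by rewrite finset.inE => /eqP ->.
  exists finset.set0; split; first by apply: n1; apply: finset.sub0set.
    by move=> I; rewrite finset.inE.
  apply/seteqP; split=> b.
    move=> nb; have /supp_span bj := WJ_inv_span Jw nb.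
    by case: wj; rewrite -(posj b) //; case: nb.
  move=> [_]; rewrite (@par_above1 [set: 'I_n]%SET) ?finset.in_set0 ?finset.subsetT //.
  by move=> I; rewrite finset.in_set0.
- have /choice[f Hf] : forall K, exists N, is_comp C J K ->
      [/\ nested N, forall I, I \in N -> I \subset K & inv (restr C K w) = invN N].
    move=> K; have [cK|cK] := boolP (is_comp C J K); last by exists finset.set0.
    by have [N HN] := IH K _ (restr_spec K Ww).1 (H K cK); exists N.
  have Hf' K : is_comp C J K -> nested (f K) /\ forall I, I \in f K -> I \subset K.
    by move=> /Hf[].
  have [nU [UJ parU]] := nested_bigcup Hf'.
  exists (\bigcup_(K in comps J) f K)%SET; split=> //; apply/seteqP; split=> b.
    move=> nb; have pb : pos b by case: nb.
    have cb := supp_conn cartanC finW pb.1.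
    have /supp_span bJ := WJ_inv_span Jw nb.
    have [K cK bK] := comp_ex_sub cb bJ; split=> //; rewrite (parU K) //.
    have [_ _ e] := Hf K cK; suff : inv (restr C K w) b by rewrite e => -[].
    exact/inv_restr.
  move=> [pb Ub]; have cb := supp_conn cartanC finW pb.1.
  have [K cK bK] := comp_ex_sub cb (par_sub UJ Ub).
  have [_ _ e] := Hf K cK; suff : inv (restr C K w) b by move=> /(inv_restr _ _ Ww)[].
  by rewrite e; split=> //; rewrite -(parU K).
have [N [nN NJi e]] := IH _ _ (restr_spec (J :\ i)%SET Ww).1 H.
have sJ : (J :\ i)%SET \subset J by apply: finset.subsetDl.
have NJ I : I \in N -> I \subset J by move=> /NJi IJ; apply: fintype.subset_trans IJ sJ.
have inJ b : pos b -> supp b \subset J -> i \notin supp b -> (inv w b <-> par N (supp b)).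
  move=> pb bJ bi; have bJi : supp b \subset (J :\ i)%SET by rewrite finset.subsetD1 bJ.
  split=> [nb|Nb].
    by have : inv (restr C (J :\ i)%SET w) b by [apply/inv_restr]; rewrite e => -[].
  by have : inv (restr C (J :\ i)%SET w) b by [rewrite e]; move=> /(inv_restr _ _ Ww)[].
(* A positive integral coordinate at [i] is at least 1, so such a root dominates [sroot i]. *)
have inU b : pos b -> supp b \subset J -> i \in supp b ->
    pos b /\ spanJ J b /\ rootle (sroot i) b.
  move=> pb bJ bi; split=> //; split; first exact/supp_span.
  move=> k; rewrite !mxE eqxx andbT; have [->|ki] := eqVneq k i; last exact: pb.2.
  by have := pb.2 i; move: bi; rewrite finset.inE; lia.
case: U => [U|U].
- have [nS SJ] := nested_symd_comps nN NJi.
  exists (J |: symd N (comps (J :\ i)))%SET; split.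
  + by apply: nested_setU1 => // I /SJ IJ; apply: fintype.subset_trans IJ sJ.
  + move=> I; rewrite finset.in_setU1 => /orP[/eqP->//|/SJ IJ].
    exact: fintype.subset_trans IJ sJ.
  + apply/seteqP; split=> b.
      move=> nb; have pb : pos b by case: nb.
      have /supp_span bJ := WJ_inv_span Jw nb; split=> //.
      rewrite (par_full iJ NJi (supp_conn cartanC finW pb.1) bJ).
      by have [//|bi] := boolP (i \in supp b); apply/inJ.
    move=> [pb]; have cb := supp_conn cartanC finW pb.1 => Nb.
    have bJ : supp b \subset J.
      apply: par_sub Nb => I; rewrite finset.in_setU1 => /orP[/eqP->//|/SJ IJ].
      exact: fintype.subset_trans IJ sJ.
    move: Nb; rewrite (par_full iJ NJi cb bJ); have [bi _|bi /=] := boolP (i \in supp b).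
      by apply: U; apply: inU.
    by move=> Nb; apply/inJ.
exists N; split=> //; apply/seteqP; split=> b.
  move=> nb; have pb : pos b by case: nb.
  have /supp_span bJ := WJ_inv_span Jw nb; split=> //; apply/inJ => //.
  apply/negP => bi; have : set0 b by rewrite -U; split=> //; apply: inU.
  by [].
move=> [pb Nb]; have bJi := par_sub NJi Nb; apply/inJ => //.
  exact: fintype.subset_trans bJi sJ.
by apply/negP => /(fintype.subsetP bJi); rewrite !finset.inE eqxx.
Qed.

End Separable.

(** * Depth *)

Section Depth.
Variables (n : nat) (C : 'M[int]_n).

Implicit Types (A I J K : {set 'I_n}) (N S : {set {set 'I_n}}) (l m : nat).

Notation conn := (connectedJ C).
Notation nested := (nested C).

Definition superset N J : {set {set 'I_n}} := [set I in N | J \proper I]%SET.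
(** The proper supersets of a member form a chain, so their number is the depth; see [depthE]. *)
Definition dep N J : nat := #|superset N J|.
Definition level N l : {set {set 'I_n}} := [set J in N | dep N J == l]%SET.
Definition below N l : {set {set 'I_n}} := [set J in N | l <= dep N J]%N%SET.

Lemma nested_comparable N I J K : nested N -> K != finset.set0 -> I \in N -> J \in N ->
  K \subset I -> K \subset J -> (I \subset J) || (J \subset I).
Proof.
move=> nN /finset.set0Pn[x xK] IN JN KI KJ.
have := nested_pair nN IN JN; rewrite orbA => /orP[//|].
by rewrite (apart_meet C (fintype.subsetP KI _ xK) (fintype.subsetP KJ _ xK)).
Qed.

Lemma dep_lt N I J : I \in N -> J \proper I -> (dep N I < dep N J)%N.
Proof.
move=> IN JI; apply: proper_card; apply/fintype.properP; split.
  apply/fintype.subsetP => K; rewrite !finset.inE => /andP[-> IK] /=.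
  exact: fintype.proper_trans JI IK.
by exists I; rewrite !finset.inE IN // fintype.properxx.
Qed.

(** A smallest proper superset [I] of [J] lies inside all the others, which are comparable with it
    since all contain the nonempty [J]. *)
Lemma dep_pred N J : nested N -> J \in N -> (0 < dep N J)%N ->
  exists I, [/\ I \in N, J \proper I & dep N J = (dep N I).+1].
Proof.
move=> nN JN /fintype.card_gt0P[I0 I0S].
have [I IS minI] := @arg_minnP _ I0 (mem (superset N J)) (fun K : {set 'I_n} => #|K|) I0S.
have /andP[IN JI] : (I \in N) && (J \proper I) by move: IS; rewrite /= finset.inE.
exists I; split=> //; rewrite /dep (finset.cardsD1 I) finset.inE IN JI add1n; congr (_.+1).
apply: eq_card => K; rewrite !finset.inE; have [->|KI] /= := eqVneq K I.
  by rewrite fintype.properxx andbF.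
case KN : (K \in N) => //=; apply/idP/idP => [JK|]; last exact: fintype.proper_trans.
have KS : K \in superset N J by rewrite finset.inE KN.
have J0 := conn_neq0 (nested_conn nN JN).
have /orP[IK|sKI] := nested_comparable nN J0 IN KN (fintype.proper_sub JI) (fintype.proper_sub JK).
  by rewrite finset.properEneq eq_sym KI.
have /eqP e : K == I by rewrite finset.eqEcard sKI; apply: minI.
by rewrite e eqxx in KI.
Qed.

Lemma dep_level N J l : nested N -> J \in N -> (l <= dep N J)%N ->
  exists2 I, I \in level N l & J \subset I.
Proof.
move=> nN; have [m] := ubnP (dep N J); elim: m J => // m IH J lt JN le.
move: le; rewrite leq_eqVlt => /orP[/eqP e|ltl].
  by exists J; rewrite // finset.inE JN e /=.
have [I [IN JI e]] := dep_pred nN JN (leq_trans (ltn0Sn l) ltl).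
have [||I' I'l II'] := IH I _ IN; [by rewrite e in lt | by rewrite e in ltl |].
by exists I' => //; apply: fintype.subset_trans (fintype.proper_sub JI) II'.
Qed.

Lemma level_apart N l I J : nested N -> I \in level N l -> J \in level N l -> I != J ->
  apart C I J.
Proof.
move=> nN; rewrite !finset.inE => /andP[IN /eqP dI] /andP[JN /eqP dJ] ne.
have /or3P[s|s|//] := nested_pair nN IN JN.
  have : I \proper J by rewrite finset.properEneq ne.
  by move/(dep_lt JN); rewrite dI dJ ltnn.
have : J \proper I by rewrite finset.properEneq eq_sym ne.
by move/(dep_lt IN); rewrite dI dJ ltnn.
Qed.

Lemma level_sub N l : level N l \subset N.
Proof. by apply/fintype.subsetP => J; rewrite finset.inE => /andP[]. Qed.

Lemma below_cover N l J : nested N -> J \in below N l ->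
  J \subset (\bigcup_(I in level N l) I)%SET.
Proof.
move=> nN; rewrite finset.inE => /andP[JN /(dep_level nN JN)[I Il JI]].
exact: fintype.subset_trans JI (finset.bigcup_sup I Il).
Qed.

Lemma below_cover_pred N l J : nested N -> J \in below N l.+1 ->
  J \subset (\bigcup_(I in level N l) I)%SET.
Proof.
move=> nN; rewrite finset.inE => /andP[JN ld]; apply: below_cover => //.
by rewrite finset.inE JN ltnW.
Qed.

Lemma dep_card N J : J \in N -> (dep N J < #|N|)%N.
Proof.
move=> JN; rewrite (finset.cardsD1 J N) JN add1n ltnS; apply: subset_leq_card.
apply/fintype.subsetP => I; rewrite !finset.inE => /andP[IN JI]; rewrite IN andbT.
by apply: contraTneq JI => ->; rewrite fintype.properxx.
Qed.

(** Members of equal depth are apart, so a connected [K] inside their union lies in exactly one of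
    them. *)
Lemma par_level N l K : nested N -> conn K ->
  par (level N l) K = (K \subset (\bigcup_(I in level N l) I)%SET).
Proof.
move=> nN cK; have [x xK] := finset.set0Pn _ (conn_neq0 cK).
have [KU|KU] := boolP (K \subset _).
  have [I Il KI] := nested_cover nN (level_sub N l) cK KU.
  rewrite (@par_above1 _ I) // => J Jl KJ.
  apply/eqP; apply: contraT => /(level_apart nN Jl Il).
  by rewrite (apart_meet C (fintype.subsetP KJ _ xK) (fintype.subsetP KI _ xK)).
by apply: contraNF KU; apply: par_sub => I Il; apply: finset.bigcup_sup.
Qed.

Lemma par_below N l K :
  par (below N l) K = par (level N l) K (+) par (below N l.+1) K.
Proof.
rewrite -par_symd /par; congr (odd #|pred_of_set _|); apply/finset.setP => J.
rewrite [in LHS]finset.inE [in RHS]finset.inE in_symd !finset.inE.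
by case: (J \in N) => //=; case: ltngtP; rewrite ?andbF.
Qed.

Lemma dep_chain N J : nested N -> J \in N -> exists t : seq {set 'I_n},
  [/\ size t = dep N J, path (fun A B : {set 'I_n} => A \proper B) J t & all (fun A => A \in N) t].
Proof.
move=> nN; have [m] := ubnP (dep N J); elim: m J => // m IH J lt JN.
have [d0|dpos] := posnP (dep N J); first by exists [::]; rewrite d0.
have [I [IN JI e]] := dep_pred nN JN dpos.
have [|t [st pt at_]] := IH I _ IN; first by rewrite e in lt.
by exists (I :: t); rewrite /= st e JI IN.
Qed.

Lemma depthE N J : nested N -> J \in N -> depth N J = dep N J.
Proof.
move=> nN JN; apply/eqP; rewrite eqn_leq; apply/andP; split.
  apply/bigmax_leqP => k /existsP[t /andP[pt at_]].
  rewrite -[X in (X <= _)%N](size_tuple t).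
  have tr : transitive (fun A B : {set 'I_n} => A \proper B).
    by move=> A1 A2 A3; apply: fintype.proper_trans.
  have ut : uniq t.
    apply: sorted_uniq tr _ _ (path_sorted pt) => A; exact: fintype.properxx.
  rewrite -(card_uniqP ut); apply: subset_leq_card; apply/fintype.subsetP => I It.
  rewrite finset.inE (allP at_) //=.
  by have /allP/(_ I It) := order_path_min tr pt.
have [t [st pt at_]] := dep_chain nN JN.
(* The maximum in [depth] ranges over chain lengths up to [#|N|], so [dep N J] is an admissible
   index. *)
have lt : (dep N J < #|N|.+1)%N by apply: ltnW; rewrite ltnS dep_card.
rewrite -[X in (X <= _)%N]/(nat_of_ord (Ordinal lt)).
apply: (@leq_bigmax_cond _ _ (fun k : 'I_(#|N|.+1) => (k : nat)) (Ordinal lt)).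
apply/existsP; have st' : size t == Ordinal lt by rewrite st.
by exists (Tuple st'); rewrite /= pt.
Qed.

End Depth.

(** * Length generating functions *)

Section LengthGeneratingFunctions.
Variables (n : nat) (C : 'M[int]_n) (R : fieldType) (q : R).
Hypotheses (cartanC : is_cartan C) (finW : finite_set (W C)).

Implicit Types (w v u x y : 'M[int]_n) (b : 'cV[int]_n).
Implicit Types (A I J K P Q : {set 'I_n}) (N S : {set {set 'I_n}}) (l m : nat).

Notation pos := (pos_roots C).
Notation conn := (connectedJ C).
Notation inv := (inv C).
Notation nested := (nested C).
Notation invN := (invN C).
Notation ell := (ell C).

(** The map sending [v] to [w *m invmx v] carries the left order ideal of [w] onto the right one and
    complements lengths to [ell w], by [leL_ell]. *)
Lemma LamL_LamR w : W C w -> q != 0 -> LamL C w q = q ^+ ell w * LamR C w q^-1.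
Proof.
move=> Ww q0; have Wv := WJV cartanC Ww; have Uw := WJ_unit cartanC Ww.
have E v : W C v -> leL C v w <-> leR C (w *m invmx v) w.
  move=> Wv'; have Vv := WJV cartanC Wv'; have Wwv := WJM Ww Vv.
  have VWwv := WJV cartanC Wwv.
  rewrite /leR !leL_ell // invmxK mulmxA mulVmx // mul1mx !ellV //.
  by rewrite addnC.
have bij : set_bij [set v | W C v /\ leL C v w] [set v | W C v /\ leR C v w]
    (fun v => w *m invmx v).
  split=> [v [Wv' H]|v v' |u [Wu H]].
  - by split; [apply: WJM => //; apply: WJV | apply/E].
  - rewrite !inE => -[Wv1 _] [Wv2 _] /(congr1 (mulmx (invmx w))); rewrite !mulKmx //.
    by move=> /(congr1 invmx); rewrite !invmxK.
  - have Wu' := WJV cartanC Wu.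
    have e : w *m invmx (invmx u *m w) = u.
      by rewrite (W_invM cartanC Wu' Ww) invmxK mulmxA mulmxV // mul1mx.
    exists (invmx u *m w) => //; split; first exact: WJM.
    by apply/E; [exact: WJM | rewrite e].
have fin (X : set 'M[int]_n) : finite_set [set v | W C v /\ X v].
  by apply: sub_finite_set finW => v [].
rewrite /LamR (reindex_fsbig _ _ _ _ bij) /LamL !fsbig_finite //; try exact: fin.
rewrite mulr_sumr big_seq [RHS]big_seq; apply: eq_bigr => v.
rewrite in_fset_set; last exact: fin.
rewrite inE => -[Wv' /leL_ell H]; rewrite -(H _ _ Wv' Ww) // exprD exprVn.
by rewrite mulrAC mulfV ?mul1r // expf_neq0.
Qed.

(** * Parabolic factorization of length sums *)

Definition gsum (X : set 'M[int]_n) : R := \sum_(v \in X) q ^+ ell v.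

(** For [Q] inside [P], the minimal-length representatives of the left cosets of [WJ C Q] in
    [WJ C P]. *)
Definition min_reps P Q : set 'M[int]_n :=
  [set u | WJ C P u /\ forall b, pos b -> spanJ Q b -> pos (u *m b)].

Lemma min_rep_mul P Q u x b : Q \subset P -> min_reps P Q u -> WJ C Q x -> spanJ Q b ->
  inv (u *m x) b <-> inv x b.
Proof.
move=> QP [Pu Hu] Qx bQ; have xbQ := WJ_span Qx bQ.
have key : pos b -> (pos (- (u *m x *m b)) <-> pos (- (x *m b))).
  move=> pb; rewrite -mulmxA.
  have [p|p] := root_sign cartanC finW (roots_W (WJW Qx) pb.1).
    by split=> H; [case: (pos_notN cartanC (Hu _ p xbQ)) | case: (pos_notN cartanC p)].
  split=> // _; rewrite -mulmxN; apply: Hu => // k /xbQ e.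
  by rewrite [LHS]mxE e oppr0.
by split=> -[pb H]; split=> //; apply/key.
Qed.

(** Each [v] factors uniquely as [u *m x] with [u] a minimal representative; lengths add, and the
    inversions of [v] in the span of [Q] are those of [x], so the condition involves only [x]. *)
Lemma gsum_parabolic P Q (X : set 'cV[int]_n) : Q \subset P ->
  gsum [set v | WJ C P v /\ forall b, inv v b -> spanJ Q b -> X b] =
  gsum (min_reps P Q) * gsum [set x | WJ C Q x /\ inv x `<=` X].
Proof.
move=> QP; rewrite /gsum.
set Z := [set v | _]; set Y := [set x | WJ C Q x /\ _].
have fin (V : set 'M[int]_n) : (forall v, V v -> W C v) -> finite_set V.
  by move=> VW; apply: sub_finite_set finW.
have finZ : finite_set Z by apply: fin => v [/WJW].
have finY : finite_set Y by apply: fin => v [/WJW].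
have finR : finite_set (min_reps P Q) by apply: fin => v [/WJW].
have bij : set_bij (min_reps P Q `*` Y) Z (fun p => p.1 *m p.2).
  split=> [[u x] [/= Ru [Qx xX]]|[u x] [u' x']|v [Pv vX]].
  - split=> [|b nb bQ]; first by apply: WJM; [case: Ru | apply: WJ_sub Qx].
    by apply: xX; apply/(min_rep_mul QP Ru Qx bQ).
  - rewrite !inE => -[/= Ru [Qx xX]] [/= Ru' [Qx' xX']] e.
    have ex : x = x'.
      apply: (inv_inj cartanC finW (WJW Qx) (WJW Qx')).
      apply/seteqP; split=> b nb.
        have bQ := WJ_inv_span Qx nb.
        by apply/(min_rep_mul QP Ru' Qx' bQ); rewrite -e; apply/(min_rep_mul QP Ru Qx bQ).
      have bQ := WJ_inv_span Qx' nb.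
      by apply/(min_rep_mul QP Ru Qx bQ); rewrite e; apply/(min_rep_mul QP Ru' Qx' bQ).
    congr (_, _) => //; move: e; rewrite -ex.
    exact: (can_inj (mulmxK (WJ_unit cartanC Qx))).
  - have Wv := WJW Pv; have [x [Qx Hx]] := parabolic_decomp cartanC finW Q Wv.
    have Px := WJ_sub QP Qx.
    have Ru : min_reps P Q (v *m invmx x).
      by split=> //; apply: WJM => //; apply: WJV.
    have e : v *m invmx x *m x = v by rewrite mulmxKV // (WJ_unit cartanC Qx).
    exists (v *m invmx x, x) => //; split=> //=; split=> // b nb.
    have bQ := WJ_inv_span Qx nb.
    by apply: vX => //; rewrite -e; apply/(min_rep_mul QP Ru Qx bQ).
rewrite (reindex_fsbig _ _ _ _ bij) -(@pair_fsbig _ _ _ _ _ _ _ (fun u x => q ^+ ell (u *m x))) //.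
rewrite !fsbig_finite // mulr_suml; apply: eq_big_seq => u.
rewrite in_fset_set // inE => Ru; rewrite fsbig_finite // mulr_sumr; apply: eq_big_seq => x.
rewrite in_fset_set // inE => -[Qx _]; rewrite -exprD; congr (_ ^+ _).
have Wx := WJW Qx; have Wux : W C (u *m x) by apply: WJM => //; case: Ru => /WJW.
have : leL C x (u *m x).
  by move=> b nb; apply/(min_rep_mul QP Ru Qx (WJ_inv_span Qx nb)).
by move=> /(leL_ell cartanC finW Wx Wux); rewrite mulmxK // (WJ_unit cartanC Qx).
Qed.

(** The roots of [A :|: B] are supported in [A] or in [B], which identifies the minimal
    representatives modulo [B] with [WJ C A]. *)
Lemma WJq_apart A B : apart C A B -> WJq C (A :|: B) q = WJq C A q * WJq C B q.
Proof.
move=> ap; have := @gsum_parabolic (A :|: B) B setT (finset.subsetUr _ _).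
have -> : [set v | WJ C (A :|: B) v /\ forall b, inv v b -> spanJ B b -> [set: 'cV[int]_n] b]
    = WJ C (A :|: B) by apply/seteqP; split=> v // [].
have -> : [set x | WJ C B x /\ inv x `<=` [set: 'cV[int]_n]] = WJ C B.
  by apply/seteqP; split=> v // [].
suff -> : min_reps (A :|: B) B = WJ C A by [].
apply/seteqP; split=> u.
  move=> [Pu Hu]; apply: (inv_sub_WJ cartanC finW (WJW Pu)) => b nb.
  have /supp_span bAB := WJ_inv_span Pu nb; apply/supp_span.
  have [pb nub] := nb.
  have [//|/supp_span bB] := conn_apart_union (supp_conn cartanC finW pb.1) bAB ap.
  by case: (pos_notN cartanC (Hu b pb bB)).
move=> Au; split=> [|b pb /supp_span bB]; first exact: WJ_sub (finset.subsetUl _ _) Au.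
rewrite (WJ_fix Au) // => i j iA bj.
have [|ij] := apartP _ _ _ ap i j iA; first by apply: (fintype.subsetP bB); rewrite finset.inE.
by rewrite (adjE cartanC) ij /= negbK => /eqP.
Qed.

Lemma WJq_set0 : WJq C finset.set0 q = 1.
Proof.
have -> : WJq C finset.set0 q = \sum_(v \in [set 1%:M]) q ^+ ell v.
  congr (\sum_(v \in _) _); apply/seteqP; split=> [v [[|i s]] [/= + ->]|v ->] //.
    by rewrite finset.in_set0.
  exact: WJ1.
by rewrite fsbig_set1 (ell1 cartanC finW) expr0.
Qed.

Lemma WJq_bigcup S : (forall I J, I \in S -> J \in S -> I != J -> apart C I J) ->
  WJq C (\bigcup_(J in S) J)%SET q = \prod_(J in S) WJq C J q.
Proof.
have [m] := ubnP #|S|; elim: m S => // m IH S lt H.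
have [->|/finset.set0Pn[J JS]] := eqVneq S finset.set0.
  by rewrite !big_set0 WJq_set0.
rewrite (big_setD1 J) //= [RHS](big_setD1 J) //= WJq_apart; last first.
  apply/apartP => i j iJ /finset.bigcupP[K]; rewrite !finset.inE => /andP[KJ KS] jK.
  by apply: (apartP _ _ _ (H J K JS KS _)) => //; rewrite eq_sym.
rewrite IH //; first by move: lt; rewrite (finset.cardsD1 J S) JS; lia.
by move=> I K; rewrite !finset.inE => /andP[_ IS] /andP[_ KS]; apply: H.
Qed.

(** Let [P] and [Q] be the unions of levels [l] and [l.+1]. On connected sets the parity for depth
    at least [l] is the sum of membership in [P], membership in [Q] and the parity for depth at
    least [l.+2]. So [v] ranges over the elements of [WJ C P] whose inversions in the span of [Q]
    satisfy the condition for [l.+2]; the minimal representatives contribute the quotient of the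
    parabolic sums, written without division. *)
Lemma gsum_level N l : nested N ->
  gsum [set v | W C v /\ inv v `<=` invN (below N l)] *
    (\prod_(J in level N l.+1) WJq C J q) =
  (\prod_(J in level N l) WJq C J q) *
    gsum [set v | W C v /\ inv v `<=` invN (below N l.+2)].
Proof.
move=> nN; set P := (\bigcup_(I in level N l) I)%SET.
set Q := (\bigcup_(I in level N l.+1) I)%SET.
have QP : Q \subset P.
  apply/finset.bigcupsP => J; rewrite finset.inE => /andP[JN /eqP dJ].
  have JB : J \in below N l.+1 by rewrite finset.inE JN dJ leqnn.
  exact: below_cover_pred nN JB.
have lev_ap k I J : I \in level N k -> J \in level N k -> I != J -> apart C I J.
  exact: level_apart.
have parE K : conn K -> par (below N l) K =
    (K \subset P) (+) ((K \subset Q) (+) par (below N l.+2) K).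
  by move=> cK; rewrite (par_below N l) (par_below N l.+1) !(par_level _ nN cK).
have par2 K : par (below N l.+2) K -> K \subset Q.
  by apply: par_sub => I IB; apply: (below_cover_pred nN IB).
have eZ : [set v | W C v /\ inv v `<=` invN (below N l)] =
    [set v | WJ C P v /\ forall b, inv v b -> spanJ Q b -> invN (below N l.+2) b].
  apply/seteqP; split=> v.
    move=> [Wv H]; split.
      apply: (inv_sub_WJ cartanC finW Wv) => b /H[_ Hb]; apply/supp_span.
      by apply: par_sub Hb => I IB; apply: (below_cover nN IB).
    move=> b /H[pb +] /supp_span bQ; rewrite parE ?(supp_conn cartanC finW pb.1) //.
    by rewrite bQ (fintype.subset_trans bQ QP) /= negbK.
  move=> [Pv H]; split=> [|b nb]; first exact: WJW Pv.
  have pb : pos b by case: nb.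
  have /supp_span bP := WJ_inv_span Pv nb; split=> //.
  rewrite parE ?(supp_conn cartanC finW pb.1) // bP.
  have [bQ|bQ] := boolP (supp b \subset Q); last first.
    by rewrite addFb addTb; apply: contra bQ => /par2.
  by have [_ ->] := H b nb ((supp_span _ _).2 bQ).
have eY : [set x | WJ C Q x /\ inv x `<=` invN (below N l.+2)] =
    [set v | W C v /\ inv v `<=` invN (below N l.+2)].
  apply/seteqP; split=> x [Wx H]; split=> //; first exact: WJW Wx.
  by apply: (inv_sub_WJ cartanC finW Wx) => b /H[_ /par2 bQ]; apply/supp_span.
have ePQ : gsum (min_reps P Q) * WJq C Q q = WJq C P q.
  have := @gsum_parabolic P Q setT QP => e.
  rewrite (_ : WJq C P q = gsum [set v | WJ C P v /\
      forall b, inv v b -> spanJ Q b -> [set: 'cV[int]_n] b]).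
    by rewrite e; congr (_ * gsum _); apply/seteqP; split=> v // [].
  by congr gsum; apply/seteqP; split=> v // [].
rewrite -!WJq_bigcup; try exact: lev_ap.
by rewrite -/P -/Q -ePQ eZ gsum_parabolic // eY mulrAC.
Qed.

(** Iterates [gsum_level] two levels at a time: for even [l], level [l] feeds the even product and
    level [l.+1] the odd one. Once [l] reaches [#|N|], no member is left and only the identity
    remains. *)
Lemma gsum_below N l : nested N -> ~~ odd l ->
  gsum [set v | W C v /\ inv v `<=` invN (below N l)] *
    (\prod_(J in below N l | odd (dep N J)) WJq C J q) =
  \prod_(J in below N l | ~~ odd (dep N J)) WJq C J q.
Proof.
move=> nN; have [m] := ubnP (#|N| - l); elim: m l => // m IH l lt ol.
have [lN|Nl] := ltnP l #|N|; last first.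
  have e : below N l = finset.set0.
    apply/finset.setP => J; rewrite !finset.inE; apply/negP => /andP[/dep_card].
    by move=> lt1 lt2; have := leq_trans (leq_trans lt1 Nl) lt2; rewrite ltnn.
  rewrite e !big1 ?mulr1; try by move=> J; rewrite finset.in_set0.
  rewrite /gsum (_ : [set v | _] = [set 1%:M]).
    by rewrite fsbig_set1 (ell1 cartanC finW) expr0.
  apply/seteqP; split=> v.
    move=> [Wv H]; apply: (pos_id cartanC finW Wv) => b pb.
    have [//|nb] := root_sign cartanC finW (roots_W Wv pb.1).
    by have [_] := H b (conj pb nb); rewrite /par (_ : above _ _ = finset.set0) ?finset.cards0 //;
      apply/finset.setP => I; rewrite !finset.inE.
  move=> ->; split; first exact: WJ1.
  by move=> b [pb]; rewrite mul1mx => /(pos_notN cartanC pb).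
(* [T] selects the parity of the depth; since [l] is even, the first level of that parity is
   [l + T]. *)
have spl (T : bool) : \prod_(J in below N l | odd (dep N J) == T) WJq C J q =
    (\prod_(J in level N (l + T)) WJq C J q) *
    \prod_(J in below N l.+2 | odd (dep N J) == T) WJq C J q.
  rewrite (bigID (mem (level N (l + T)))) /=; congr (_ * _); apply: eq_bigl => J;
    rewrite !finset.inE; case: (J \in N) => //=.
    by move: (dep N J) ol => d; case: T; rewrite /= ?eqb_id ?eqbF_neg; lia.
  by move: (dep N J) ol => d; case: T; rewrite /= ?eqb_id ?eqbF_neg; lia.
have e1 : \prod_(J in below N l | odd (dep N J)) WJq C J q =
    (\prod_(J in level N l.+1) WJq C J q) *
    \prod_(J in below N l.+2 | odd (dep N J)) WJq C J q.
  have := spl true; rewrite addn1; under eq_bigl do rewrite eqb_id.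
  by under [X in _ = _ * X]eq_bigl do rewrite eqb_id.
have e0 : \prod_(J in below N l | ~~ odd (dep N J)) WJq C J q =
    (\prod_(J in level N l) WJq C J q) *
    \prod_(J in below N l.+2 | ~~ odd (dep N J)) WJq C J q.
  have := spl false; rewrite addn0; under eq_bigl do rewrite eqbF_neg.
  by under [X in _ = _ * X]eq_bigl do rewrite eqbF_neg.
rewrite e1 e0 mulrA gsum_level // -mulrA IH //; last by rewrite /= negbK.
by move: lt lN; lia.
Qed.

Lemma LamL_product N w : nested N -> W C w -> inv w = invN N ->
  LamL C w q * (\prod_(J in N | odd (depth N J)) WJq C J q) =
  \prod_(J in N | ~~ odd (depth N J)) WJq C J q.
Proof.
move=> nN Ww e; have b0 : below N 0 = N by apply/finset.setP => J; rewrite finset.inE andbT.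
have := @gsum_below N 0 nN isT; rewrite b0 -e => H.
have d (p : bool -> bool) : \prod_(J in N | p (odd (depth N J))) WJq C J q =
    \prod_(J in N | p (odd (dep N J))) WJq C J q.
  apply: eq_bigl => J; case JN : (J \in N) => //=; by rewrite (depthE nN JN).
by rewrite (d id) (d negb).
Qed.

End LengthGeneratingFunctions.

(** * Faces of the graph associahedron *)

Section Faces.
Variables (n : nat) (C : 'M[int]_n) (F : realFieldType).

Implicit Types (i j k : 'I_n) (A I J K : {set 'I_n}) (N S : {set {set 'I_n}}).
Implicit Types (c x y z : 'rV[F]_n).

Notation conn := (connectedJ C).
Notation nested := (nested C).
Notation comps := (comps C).
Notation adj := (adj C).

Definition dot c x : F := \sum_i c 0 i * x 0 i.

Definition argmax c J : {set 'I_n} := [set j in J | [forall k in J, c 0 k <= c 0 j]]%SET.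

Lemma argmaxP c J j : reflect (j \in J /\ forall k, k \in J -> c 0 k <= c 0 j) (j \in argmax c J).
Proof.
rewrite finset.inE; apply: (iffP andP) => -[jJ H]; split=> //.
  by move=> k kJ; move/forallP/(_ k)/implyP: H; apply.
by apply/forallP => k; apply/implyP; apply: H.
Qed.

Lemma argmax_exists c J : conn J -> exists j, j \in argmax c J.
Proof.
move=> /conn_neq0/finset.set0Pn[i0 i0J].
have [j jJ H] := @Order.TotalTheory.arg_maxP _ _ _ i0 (mem J) (fun i => c 0 i) i0J.
by exists j; apply/argmaxP; split=> // k kJ; apply: H.
Qed.

Definition face c : set 'rV[F]_n := [set x | assoc C x /\
  forall y, assoc C y -> dot c y <= dot c x].

Lemma dot_sum c (P : pred {set 'I_n}) (y : {set 'I_n} -> 'rV[F]_n) :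
  dot c (\sum_(J | P J) y J) = \sum_(J | P J) dot c (y J).
Proof.
rewrite /dot exchange_big; apply: eq_bigr => i _ /=.
by rewrite summxE mulr_sumr.
Qed.

Lemma simplex_delta J j : j \in J -> simplexJ J (delta_mx 0 j : 'rV[F]_n).
Proof.
move=> jJ; split=> [i|]; first by rewrite !mxE /=; case: (_ == _); rewrite ?ler01.
split=> [i iJ|].
  by rewrite !mxE /=; have [e|//] := eqVneq i j; rewrite e jJ in iJ.
rewrite (bigD1 j) //= big1 => [|i /negPf ij]; last by rewrite !mxE ij.
by rewrite !mxE !eqxx addr0.
Qed.

(** The difference [c 0 j - dot c y] is a sum of nonnegative terms [(c 0 j - c 0 i) * y 0 i], so it
    vanishes only if each term does. *)
Lemma dot_simplex c J j y : simplexJ J y -> j \in argmax c J ->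
  dot c y <= c 0 j /\ (dot c y = c 0 j <-> forall i, y 0 i != 0 -> i \in argmax c J).
Proof.
move=> [y0 [yJ ys]] /argmaxP[jJ jm].
have e : c 0 j - dot c y = \sum_i (c 0 j - c 0 i) * y 0 i.
  rewrite -[c 0 j in LHS]mulr1 -ys mulr_sumr -sumrB; apply: eq_bigr => i _.
  by rewrite mulrBl.
have pos i : 0 <= (c 0 j - c 0 i) * y 0 i.
  have [iJ|/yJ ->] := boolP (i \in J); last by rewrite mulr0.
  by rewrite mulr_ge0 // subr_ge0 jm.
split; first by rewrite -subr_ge0 e sumr_ge0.
split=> [/eqP|H].
  rewrite eq_sym -subr_eq0 e psumr_eq0 // => /allP H i yi.
  have /implyP/(_ isT) := H i (mem_index_enum i).
  rewrite mulf_eq0 (negPf yi) orbF subr_eq0 => /eqP ci.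
  apply/argmaxP; split=> [|k kJ]; first by apply: contraNT yi => /yJ ->.
  by rewrite -ci jm.
apply/eqP; rewrite eq_sym -subr_eq0 e; apply/eqP/big1 => i _.
have [->|/H/argmaxP[iJ im]] := eqVneq (y 0 i) 0; first by rewrite mulr0.
have -> : c 0 j = c 0 i by apply/le_anti; rewrite im // jm.
by rewrite subrr mul0r.
Qed.

(** A linear functional is maximized on a Minkowski sum summand by summand. *)
Lemma face_sum c (y : {set 'I_n} -> 'rV[F]_n) : (forall J, conn J -> simplexJ J (y J)) ->
  face c (\sum_(J | conn J) y J) <->
  forall J, conn J -> forall i, y J 0 i != 0 -> i \in argmax c J.
Proof.
move=> Sy; have /choice[top Htop] : forall J, exists m : F, conn J ->
    exists2 j, j \in argmax c J & m = c 0 j.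
  move=> J; have [cJ|cJ] := boolP (conn J); last by exists 0.
  by have [j jm] := argmax_exists c cJ; exists (c 0 j) => _; exists j.
have le z J : conn J -> simplexJ J z -> dot c z <= top J /\
    (dot c z = top J <-> forall i, z 0 i != 0 -> i \in argmax c J).
  by move=> cJ Sz; have [j jm ->] := Htop J cJ; apply: dot_simplex.
split=> [[_ H] J cJ|H].
  apply/(proj2 (le _ _ cJ (Sy J cJ))).
  (* The comparison point takes from each simplex a vertex where [c] is maximal; 0 is a default off
     the connected sets. *)
  have /choice[e He] : forall J, exists z, conn J -> exists2 j, j \in argmax c J & z = delta_mx 0 j.
    move=> K; have [cK|cK] := boolP (conn K); last by exists 0.
    by have [j jm] := argmax_exists c cK; exists (delta_mx 0 j) => _; exists j.
  have Se K : conn K -> simplexJ K (e K).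
    by move=> /He[j /argmaxP[jK _] ->]; apply: simplex_delta.
  have te K : conn K -> dot c (e K) = top K.
    move=> cK; apply/(proj2 (le _ _ cK (Se K cK))) => i; have [j jm ->] := He K cK.
    by rewrite mxE /=; have [->|] := eqVneq i j; rewrite ?eqxx.
  have /H : assoc C (\sum_(K | conn K) e K) by exists e.
  rewrite !dot_sum -subr_ge0 -sumrB => ge0.
  have top_ge K : conn K -> 0 <= top K - dot c (y K).
    by move=> cK; rewrite subr_ge0; apply: (le _ _ cK (Sy K cK)).1.
  have : \sum_(K | conn K) (top K - dot c (y K)) = 0.
    apply/le_anti/andP; split; last exact: sumr_ge0.
    rewrite -oppr_ge0 -sumrN (eq_bigr (fun K => dot c (y K) - dot c (e K))) // => K cK.
    by rewrite te // opprB.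
  move=> /eqP; rewrite psumr_eq0 //.
  move=> /allP/(_ J (mem_index_enum J))/implyP/(_ cJ).
  by rewrite subr_eq0 => /eqP.
split; first by exists y.
move=> _ [z [Sz ->]]; rewrite !dot_sum; apply: ler_sum => J cJ.
have [_ [_ ->]] := le _ _ cJ (Sy J cJ); last exact: H.
exact: (le _ _ cJ (Sz J cJ)).1.
Qed.

Lemma face_argmax c c' : face c = face c' <-> forall J, conn J -> argmax c J = argmax c' J.
Proof.
have sub a b : face a `<=` face b -> forall J, conn J -> argmax a J \subset argmax b J.
  move=> ab J cJ; apply/fintype.subsetP => j0 j0m.
  have /choice[e He] : forall K, exists z, conn K ->
      exists2 j, j \in argmax a K & z = delta_mx 0 j.
    move=> K; have [cK|cK] := boolP (conn K); last by exists 0.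
    by have [j jm] := argmax_exists a cK; exists (delta_mx 0 j) => _; exists j.
  (* Prescribing the vertex [j0] for the summand [J] gives a point of the face of [a], hence of the
     face of [b], which forces [j0] into [argmax b J]. *)
  pose y K := if K == J then delta_mx 0 j0 : 'rV[F]_n else e K.
  have yE K : conn K -> exists2 j, j \in argmax a K & y K = delta_mx 0 j.
    by move=> cK; rewrite /y; have [->|_] := eqVneq K J; [exists j0 | apply: He].
  have Sy K : conn K -> simplexJ K (y K).
    by move=> /yE[j /argmaxP[jK _] ->]; apply: simplex_delta.
  have /ab/(face_sum _ Sy)/(_ J cJ j0) : face a (\sum_(K | conn K) y K).
    apply/(face_sum _ Sy) => K cK i; have [j jm ->] := yE K cK.
    by rewrite mxE /=; have [->|] := eqVneq i j; rewrite ?eqxx.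
  by rewrite /y eqxx !mxE !eqxx; apply; apply: oner_neq0.
split=> [e J cJ|H].
  by apply/eqP; rewrite finset.eqEsubset !sub // e.
by apply/seteqP; split=> x fx; have [[y [Sy ex]] _] := fx; rewrite ex in fx *;
  apply/(face_sum _ Sy) => J cJ i yi; [rewrite -H | rewrite H] => //;
  move/(face_sum _ Sy): fx; apply.
Qed.

(* The connected components of the sublevel sets of [c]. *)
Definition nest c : {set {set 'I_n}} := [set J | conn J &&
  [forall i in J, forall j in J, forall k, (k \notin J) ==> adj j k ==> (c 0 i < c 0 k)]]%SET.

Lemma nestP c J : reflect (conn J /\ forall i j k, i \in J -> j \in J -> k \notin J ->
  adj j k -> c 0 i < c 0 k) (J \in nest c).
Proof.
rewrite finset.inE; apply: (iffP andP) => -[cJ H]; split=> //.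
  move=> i j k iJ jJ kJ jk; move/forallP/(_ i)/implyP/(_ iJ)/forallP/(_ j)/implyP/(_ jJ): H.
  by move=> /forallP/(_ k)/implyP/(_ kJ)/implyP; apply.
apply/forallP => i; apply/implyP => iJ; apply/forallP => j; apply/implyP => jJ.
by apply/forallP => k; apply/implyP => kJ; apply/implyP; apply: H.
Qed.

(** If [c] is maximal on [J] at [j], no edge of [J] leaves a member of the nest containing [j],
    because [c] would be larger beyond it. Conversely, the component through [j] of the set where
    [c] is at most [c 0 j] belongs to the nest. *)
Lemma argmax_nest c J : conn J ->
  argmax c J = [set j in J | [forall I in nest c, (j \in I) ==> (J \subset I)]]%SET.
Proof.
move=> cJ; apply/finset.setP => j; rewrite [in RHS]finset.inE.
apply/argmaxP/andP => -[jJ H]; split=> //.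
  apply/forallP => I; apply/implyP => /nestP[cI HI]; apply/implyP => jI.
  have [<-|ne] := eqVneq (J :&: I)%SET J; first exact: finset.subsetIr.
  have [|i [k []]] := conn_cut cJ (finset.subsetIl J I) _ ne.
    by apply/finset.set0Pn; exists j; rewrite finset.inE jJ.
  rewrite !finset.inE => /andP[iJ iI] kJ; rewrite kJ /= => kI ik.
  by have := HI j i k jI iI kI ik; rewrite ltNge H.
move=> k kJ; rewrite leNgt; apply/negP => lt.
pose L : {set 'I_n} := [set i | c 0 i <= c 0 j]%SET.
have jL : j \in L by rewrite finset.inE.
have [I cI jI] := comp_ex C jL.
have IL i : i \in I -> c 0 i <= c 0 j.
  by move=> /(fintype.subsetP (comp_sub cI)); rewrite finset.inE.
have IN : I \in nest c.
  apply/nestP; split; first exact: comp_conn cI.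
  move=> i i' l iI i'I lI il; apply: le_lt_trans (IL i iI) _; rewrite ltNge; apply/negP => le.
  have /and3P[_ _ /forallP/(_ i')/implyP/(_ i'I)/forallP/(_ l)/implyP] := cI.
  by rewrite !finset.inE lI le il => /(_ isT).
move/forallP/(_ I)/implyP/(_ IN)/implyP/(_ jI)/fintype.subsetP/(_ k kJ)/IL: H.
by rewrite leNgt lt.
Qed.

Lemma nest_argmax c c' : nest c = nest c' <-> forall J, conn J -> argmax c J = argmax c' J.
Proof.
split=> [e J cJ|H]; first by rewrite !argmax_nest // e.
have sub a b : (forall J, conn J -> argmax a J = argmax b J) -> nest a \subset nest b.
  move=> ab; apply/fintype.subsetP => J /nestP[cJ HJ]; apply/nestP; split=> // i j k iJ jJ kJ jk.
  (* For [k] adjacent to the connected [J], the values of [c] on [J] are all below [c 0 k] exactly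
     when [c] attains its maximum on [J :|: [set k]] at [k] alone; so the maximizers determine the
     nest. *)
  have cJk : conn (J :|: [set k]).
    by apply: conn_setU (conn1 C k) jJ (finset.set11 k) _ => //; rewrite jk orbT.
  have akE : argmax a (J :|: [set k]) = [set k]%SET.
    apply/finset.setP => l; rewrite [in RHS]finset.inE; apply/argmaxP/eqP => [[]|->].
      rewrite !finset.inE => /orP[lJ|/eqP //] /(_ k).
      by rewrite !finset.inE eqxx orbT leNgt (HJ l j k) // => /(_ isT).
    split; first by rewrite !finset.inE eqxx orbT.
    by move=> l'; rewrite !finset.inE => /orP[l'J|/eqP->//]; rewrite ltW // (HJ l' j).
  rewrite ab // in akE; rewrite ltNge; apply/negP => ki.
  have kM : k \in argmax b (J :|: [set k]) by rewrite akE finset.inE.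
  have : i \in argmax b (J :|: [set k]).
    move: kM => /argmaxP[_ km]; apply/argmaxP; split; first by rewrite finset.inE iJ.
    by move=> l /km lk; apply: le_trans lk ki.
  by rewrite akE finset.inE => /eqP e; rewrite -e iJ in kJ.
apply/eqP; rewrite finset.eqEsubset !sub // => J cJ; by rewrite H.
Qed.

Lemma nest_nested c : nested (nest c) /\ comps [set: 'I_n]%SET \subset nest c.
Proof.
split; last first.
  apply/fintype.subsetP => K; rewrite finset.inE => cK; apply/nestP.
  split=> [|i j k iK jK kK jk]; first exact: comp_conn cK.
  have /and3P[_ _ /forallP/(_ j)/implyP/(_ jK)/forallP/(_ k)/implyP] := cK.
  by rewrite !finset.inE kK jk => /(_ isT).
apply/nestedP; split=> [J /nestP[] //|I J IN JN].
(* When two members meet and the first is not inside the second, an edge of the first leaves the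
   second and reaches a vertex where [c] exceeds all its values on the second; this cannot hold both
   ways. *)
have exc A B a : A \in nest c -> B \in nest c -> a \in A -> a \in B -> ~~ (A \subset B) ->
    exists2 k, k \in A & forall j, j \in B -> c 0 j < c 0 k.
  move=> /nestP[cA HA] /nestP[cB HB] aA aB AB.
  have ne : (A :&: B)%SET != A by apply: contraNneq AB => <-; apply: finset.subsetIr.
  have [|i [k []]] := conn_cut cA (finset.subsetIl A B) _ ne.
    by apply/finset.set0Pn; exists a; rewrite finset.inE aA.
  rewrite !finset.inE => /andP[iA iB] kA; rewrite kA /= => kB ik.
  by exists k => // j jB; apply: HB ik.
case: (boolP (I \subset J)) => //= IJ; case: (boolP (J \subset I)) => //= JI.
apply/apartP => i j iI jJ.
have disj a : a \in I -> a \in J -> False.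
  move=> aI aJ; have [k kI Hk] := exc I J a IN JN aI aJ IJ.
  have [l lJ Hl] := exc J I a JN IN aJ aI JI.
  by have := lt_trans (Hk l lJ) (Hl k kI); rewrite ltxx.
split; first by apply/eqP => e; apply: (disj i) => //; rewrite e.
apply/negP => ij; have /nestP[_ HI] := IN; have /nestP[_ HJ] := JN.
have jI : j \notin I by apply/negP => jI; apply: disj jI jJ.
have iJ : i \notin J by apply/negP => iJ; apply: disj iI iJ.
have := lt_trans (HI i i j iI iI jI ij) (HJ j j i jJ jJ iJ _).
by rewrite adjC ij ltxx => /(_ isT).
Qed.

(* Take for [- c] the number of members of [N] containing a vertex. *)
Lemma nest_surj N : nested N -> comps [set: 'I_n]%SET \subset N -> exists c, nest c = N.
Proof.
move=> nN cN; pose cnt i := #|[set I in N | i \in I]%SET|.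
pose c : 'rV[F]_n := \row_i - (cnt i)%:R.
have cE i k : (c 0 i < c 0 k) = (cnt k < cnt i)%N by rewrite !mxE ltrN2 ltr_nat.
exists c; apply/finset.setP => J; apply/nestP/idP => [[cJ HJ]|JN]; last first.
  split=> [|i j k iJ jJ kJ jk]; first exact: nested_conn nN JN.
  rewrite cE; apply: proper_card; apply/fintype.properP; split.
    apply/fintype.subsetP => I; rewrite !finset.inE => /andP[IN kI]; rewrite IN /=.
    have /or3P[JI|IJ|/apartP/(_ j k jJ kI)[_]] := nested_pair nN JN IN; last by rewrite jk.
      exact: (fintype.subsetP JI).
    by rewrite (fintype.subsetP IJ) in kJ.
  by exists J; rewrite !finset.inE JN ?iJ ?(negPf kJ).
have [K cK JK] := comp_ex_sub cJ (finset.subsetT J).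
have KN : K \in N by apply: (fintype.subsetP cN); rewrite finset.inE.
have P0 : (K \in N) && (J \subset K) by rewrite KN.
(* [I] is a smallest member containing [J]. If [J] differs from it, an edge of [I] leaves [J] to
   some [x], and every vertex of [J] lies in more members than [x], hence in a member properly
   inside [I]; by [nested_cover] one of these contains [J], against minimality. *)
have [I /andP[IN JI] minI] := @arg_minnP _ K (fun I => (I \in N) && (J \subset I))
  (fun K : {set 'I_n} => #|K|) P0.
have [-> //|JnI] := eqVneq J I.
have [j [x [jJ xI xJ jx]]] := conn_cut (nested_conn nN IN) JI (conn_neq0 cJ) JnI.
pose S := [set I' in N | I' \proper I]%SET.
have SN : S \subset N by apply/fintype.subsetP => I'; rewrite finset.inE => /andP[].
have JS : J \subset (\bigcup_(I' in S) I')%SET.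
  apply/fintype.subsetP => i iJ; have := HJ i j x iJ jJ xJ jx; rewrite cE => lt.
  apply: contraLR lt => iS; rewrite -leqNgt; apply: subset_leq_card.
  apply/fintype.subsetP => I'; rewrite !finset.inE => /andP[I'N iI']; rewrite I'N /=.
  have /or3P[II'|I'I|] := nested_pair nN IN I'N.
  - exact: (fintype.subsetP II').
  - have [->//|ne] := eqVneq I' I; case/negP: iS; apply/finset.bigcupP; exists I' => //.
    by rewrite finset.inE I'N finset.properEneq ne.
  - by rewrite (apart_meet C (fintype.subsetP JI _ iJ) iI').
have [I' ] := nested_cover nN SN cJ JS; rewrite finset.inE => /andP[I'N I'I] JI'.
have := minI I'; rewrite I'N JI' => /(_ isT); rewrite leqNgt.
by rewrite proper_card.
Qed.

(** * Counting nested sets and faces *)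

Lemma card_finset_II (T : finType) (X : {set T}) : [set` X] #= `I_#|X|.
Proof.
have -> : [set` X] = enum_val @` [set: 'I_#|X|].
  apply/seteqP; split=> [x /= xX|_ [i _ <-]]; last exact: enum_valP.
  by exists (enum_rank_in xX x) => //; rewrite enum_rankK_in.
apply: card_eq_trans (card_esym card_II).
by apply: inj_card_eq => i j _ _; apply: enum_val_inj.
Qed.

Definition nested_sets : {set {set {set 'I_n}}} := [set N | `[< nested N >]]%SET.
Definition full_nested_sets : {set {set {set 'I_n}}} :=
  [set N in nested_sets | comps [set: 'I_n]%SET \subset N]%SET.

(* A nested set is a set of connected components together with a nested set
   containing all of them. *)
Lemma card_nested_sets : #|nested_sets| = (2 ^ ncomp C * #|full_nested_sets|)%N.
Proof.
set T := comps [set: 'I_n]%SET.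
have -> : ncomp C = #|T| by [].
rewrite -card_powerset -finset.cardsX.
pose f N := ((N :&: T)%SET, (N :|: T)%SET).
have fK : cancel f (fun p => (p.2 :\: T) :|: p.1)%SET.
  move=> N; apply/finset.setP => J; rewrite !finset.inE.
  by case: (J \in N); case: (is_comp _ _ _).
rewrite -(finset.card_imset _ (can_inj fK)); congr #|pred_of_set _|.
apply/finset.setP => -[M N]; rewrite [in RHS]finset.inE /=.
apply/finset.imsetP/andP => [[N0 + [-> ->]]|[]].
  rewrite finset.inE => /asboolP nN0; split; first by rewrite finset.inE finset.subsetIr.
  rewrite !finset.inE finset.subsetUr andbT; apply/asboolP.
  exact: (nested_comps nN0 (fun I _ => finset.subsetT I)).
rewrite !finset.inE => MT /andP[/asboolP nN TN].
have MN := fintype.subset_trans MT TN.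
exists ((N :\: T) :|: M)%SET.
  rewrite finset.inE; apply/asboolP/(nested_sub _ nN).
  by rewrite finset.subUset finset.subsetDl.
congr (_, _); apply/finset.setP => J; have := fintype.subsetP MT J; have := fintype.subsetP TN J;
  rewrite !finset.inE; case: (J \in N); case: (J \in M); case: (is_comp _ _ _) => //= a b;
  by [have := a isT | have := b isT].
Qed.

(** A face is determined by the nest of any functional exposing it, and the nests are exactly the
    nested sets that contain all components. *)
Lemma card_faces : @faces n C F #= `I_#|full_nested_sets|.
Proof.
have /choice[c Hc] : forall N, exists c, N \in full_nested_sets -> nest c = N.
  move=> N; have [|NF] := boolP (N \in full_nested_sets); last by exists 0.
  rewrite !finset.inE => /andP[/asboolP nN cN].
  by have [c e] := nest_surj nN cN; exists c.
have -> : @faces n C F = (fun N => face (c N)) @` [set` full_nested_sets].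
  apply/seteqP; split=> [_ [a ->]|_ [N NF <-]]; last by exists (c N).
  have [nn nc] := nest_nested a.
  have NF : nest a \in full_nested_sets by rewrite !finset.inE nc andbT; apply/asboolP.
  by exists (nest a) => //; apply/face_argmax/nest_argmax; rewrite Hc.
apply: card_eq_trans (card_finset_II _); apply: inj_card_eq => N N'.
rewrite !inE /= => NF N'F /face_argmax/nest_argmax.
by rewrite !Hc.
Qed.

End Faces.

(** * Bijection, enumeration and generating functions *)

Theorem theorem5p2 (n : nat) (C : 'M[int]_n) (R : fieldType) (F : realFieldType) :
  is_cartan C -> finite_set (W C) ->
  (* (1) well-defined bijection nested sets -> separable elements *)
  (exists f : {set {set 'I_n}} -> 'M[int]_n,
     (forall N, nested C N ->
        (exists s, monotonic N s) /\
        (forall s, monotonic N s -> wprod C s = f N)) /\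
     (forall N1 N2, nested C N1 -> nested C N2 -> f N1 = f N2 -> N1 = N2) /\
     (forall N, nested C N -> separable C (f N)) /\
     (forall w, separable C w -> exists N, nested C N /\ f N = w)) /\
  (* counting consequence *)
  (exists m : nat, @faces n C F #= `I_m /\ separable C #= `I_(2 ^ ncomp C * m)) /\
  (* (2) generating functions *)
  (forall N s, nested C N -> monotonic N s ->
     let w := wprod C s in
     (forall q : R, q != 0 ->
        LamL C w q = q ^+ ell C w * LamR C w q^-1) /\
     (forall q : R,
        \prod_(J in N | odd (depth N J)) WJq C J q != 0 ->
        LamL C w q = (\prod_(J in N | ~~ odd (depth N J)) WJq C J q)
                     / (\prod_(J in N | odd (depth N J)) WJq C J q))).
Proof.
move=> cartanC finW.
have /choice[mono monoP] := @monotonic_exists n.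
pose f N := wprod C (mono N).
have fW N : W C (f N) by apply: wprod_W.
have finv N : nested C N -> inv C (f N) = invN C N.
  by move=> nN; apply: inv_wprod.
have f_inj N1 N2 : nested C N1 -> nested C N2 -> f N1 = f N2 -> N1 = N2.
  (* Every connected [K] is the support of a positive root, so the inversions of [f N] determine all
     parities. *)
  move=> n1 n2 e; apply: (par_inj (fun J => nested_conn n1) (fun J => nested_conn n2)) => K cK.
  have [b [pb <-]] := conn_supp cartanC finW cK.
  have /seteqP[s12 s21] : invN C N1 = invN C N2 by rewrite -!finv // e.
  apply/idP/idP => H; first by have [] := s12 b (conj pb H).
  by have [] := s21 b (conj pb H).
have f_sep N : nested C N -> separable C (f N).
  move=> nN; split=> //; apply: (nested_sep cartanC finW _ (fW N) nN _ (finv N nN)).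
    by rewrite finset.cardsT card_ord.
  by move=> I _; apply: finset.subsetT.
have f_surj w : separable C w -> exists N, nested C N /\ f N = w.
  move=> [Ww /(sep_nested cartanC finW Ww)[N [nN _ e]]]; exists N; split=> //.
  by apply: (inv_inj cartanC finW (fW N) Ww); rewrite finv.
split; [exists f; split; [|by []] | split].
- move=> N nN; split=> [|s sN]; first by exists (mono N).
  apply: (inv_inj cartanC finW (wprod_W cartanC finW s) (fW N)).
  by rewrite (inv_wprod cartanC finW nN sN) finv.
- exists #|full_nested_sets C|; split; first exact: card_faces.
  rewrite -card_nested_sets; have -> : separable C = f @` [set` nested_sets C].
    apply/seteqP; split=> [w /f_surj[N [nN <-]]|_ [N + <-]].
      by exists N => //=; rewrite finset.inE; apply/asboolP.
    by rewrite /= finset.inE => /asboolP /f_sep.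
  apply: card_eq_trans (card_finset_II _); apply: inj_card_eq => N N'.
  move=> /set_mem /= + /set_mem /=; rewrite !finset.inE => /asboolP nN /asboolP nN'.
  exact: f_inj.
move=> N s nN sN w; have Ww : W C w by apply: wprod_W.
split=> [q q0|q D0]; first exact: LamL_LamR.
rewrite -(LamL_product q cartanC finW nN Ww (inv_wprod cartanC finW nN sN)).
by rewrite mulfK.
Qed.
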